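(* Let $N\ge 1$, $\alpha_1,\dots,\alpha_N\in\{0,1\}$, $R(z)=\exp(r(z))\in \mathrm{Id}+z\,\mathrm{End}(\mathbb C^N)[[z]]$, $T(z)=\sum_{j\ge1}\sum_a\Delta T^a_j z^j\tilde e_a\in z\mathbb C^N[[z]]$ with $\Delta T_1^a=0$ whenever $\alpha_a=1$, and $\Delta=(\Delta_1,\dots,\Delta_N)\in\mathbb C^N$ (with fixed square roots). Let $Z=\widehat R\,\widehat T\,\widehat\Delta\cdot\prod_{a=1}^N\tau_{\alpha_a}(\hbar,\mathbf T^a)$ be the associated generalized ancestor potential, and let $$\widehat H=\widehat R\,\widehat V\Big(\sum_{a=1}^N\frac{\widehat L_0(\mathbf T^a)}{2\alpha_a+1}\Big)\widehat V^{-1}\widehat R^{-1}$$ (all operators are defined in the context). Then $$\hbar\frac{\partial}{\partial\hbar}Z=\widehat H\cdot Z .$$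
   Context: Notation. $(2k-1)!!=1\cdot3\cdots(2k-1)$, $(-1)!!=1$. $\mathbb C^N$ has orthonormal basis $\tilde e_1,\dots,\tilde e_N$. Formal variables $\mathbf T=\{T^a_k\}_{1\le a\le N,\,k\ge0}$, $\mathbf T^a=\{T^a_k\}_{k\ge0}$; $T_k^a$ and $\partial/\partial T_k^a$ are $0$ for $k<0$. Operators are (formal completions of) differential operators acting on $\mathbb C[\mathbf T][[\hbar]]$. Virasoro operators in one family $\{T_k\}_{k\ge 0}$: $$\widehat L_m=\tfrac12\sum_{i+j=-m-1}\frac{T_iT_j}{(2i-1)!!(2j-1)!!}+\sum_{k\ge0}\frac{(2k+2m+1)!!}{(2k-1)!!}T_k\frac{\partial}{\partial T_{k+m}}+\tfrac12\sum_{i+j=m-1}(2i+1)!!(2j+1)!!\frac{\partial^2}{\partial T_i\partial T_j};$$ $\widehat L_m(\mathbf T^a)$ is this operator in the variables $\mathbf T^a$. In particular $\widehat L_0(\mathbf T^a)=\sum_{k\ge0}(2k+1)T^a_k\,\partial/\partial T^a_k$ (no sum over $a$). Tau-functions. $\tau_1$ is the Kontsevich--Witten tau-function $\tau_1(\hbar,\mathbf T)=\exp\big(\sum_{2g-2+n>0}\frac{\hbar^{2g-2+n}}{n!}\sum_{k_1,\dots,k_n\ge0}\int_{\overline{\mathcal M}_{g,n}}\psi_1^{k_1}\cdots\psi_n^{k_n}\,T_{k_1}\cdots T_{k_n}\big)$; $\tau_0$ is the Brézin--Gross--Witten tau-function, given by the same formula with Norbury's class $\Theta_{g,n}\in H^{4g-4+2n}(\overline{\mathcal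 M}_{g,n})$ inserted in the integral. Equivalently (known), $\tau_\alpha$ is the unique element of $\mathbb C[\mathbf T][[\hbar]]$ with $\tau_\alpha|_{\mathbf T=0}=1$ and $\big(\tfrac12\widehat L_k-\frac{(2k+2\alpha+1)!!}{2\hbar}\frac{\partial}{\partial T_{k+\alpha}}+\frac{\delta_{k,0}}{16}\big)\tau_\alpha=0$ for all $k\ge-\alpha$. Operators. Write $r(z)=\sum_{k\ge1}r_kz^k$, $r_k\tilde e_a=\sum_b(r_k)^b_a\tilde e_b$, $(r_k)^{ab}=(r_k)_a^b$. Then $$\widehat R=\exp\Big(\sum_{k\ge1}\sum_{a,b}\Big(\sum_{j\ge0}(r_k)^b_aT^a_j\frac{\partial}{\partial T^b_{k+j}}+\tfrac12\sum_{j=0}^{k-1}(-1)^{j+1}(r_k)^{ab}\frac{\partial^2}{\partial T^a_j\partial T^b_{k-j-1}}\Big)\Big),$$ $$\widehat T=\exp\Big(\frac1\hbar\sum_{k\ge1}\sum_a\Delta T^a_k\frac{\partial}{\partial T^a_k}\Big),\qquad \widehat\Delta\cdot\prod_a\tau_{\alpha_a}(\hbar,\mathbf T^a)=\prod_a\tau_{\alpha_a}(\hbar\sqrt{\Delta_a},\mathbf T^a).$$ No symplectic condition on $R$ is assumed. Virasoro group element. For each $a$ let $v^a(z)=\sqrt{\Delta_a}\sum_{k\ge1+\alpha_a}\frac{\Delta T^a_k}{(2k+1)!!}z^{2k+1}$ and $f^a(z)=z\big(1-(2\alpha_a+1)v^a(z)/z^{2\alpha_a+1}\big)^{1/(2\alpha_a+1)}\in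 z+z^3\mathbb C[[z^2]]$. Let $\chi^a_k$ ($k\ge1$) be the unique constants with $f^a(z)=\exp\big(-\sum_{k\ge1}\chi_k^az^{2k+1}\frac{\partial}{\partial z}\big)\cdot z$. Then $\widehat V=\prod_{a=1}^N\exp\big(\sum_{k\ge1}\chi^a_k\widehat L_k(\mathbf T^a)\big)$. *)

(* Defs.v *)
From HB Require Import structures.
From mathcomp Require Import all_boot all_order all_algebra.
From mathcomp Require Import finmap.
From mathcomp Require Import mathcomp_extra boolp classical_sets cardinality fsbigop.
From mathcomp.multinomials Require Import monalg.
From mathcomp.real_closed Require Import complex.
From mathcomp Require Import reals.

Set Implicit Arguments.
Unset Strict Implicit.
Unset Printing Implicit Defensive.

Import Order.TTheory GRing.Theory Num.Theory.
Local Open Scope ring_scope.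

(* dfact n is (2n - 1)!!, so (2n + 1)!! is dfact n.+1 and (-1)!! = dfact 0 = 1. *)
Definition dfact (n : nat) : nat := (\prod_(i < n) i.*2.+1)%N.

Section Series.

Variable A : pzSemiRingType.

Definition smul (f g : nat -> A) : nat -> A :=
  fun n => \sum_(i < n.+1) f i * g (n - i)%N.

Definition sone : nat -> A := fun n => (n == 0%N)%:R.

Definition spow (f : nat -> A) (j : nat) : nat -> A := iter j (smul f) sone.

End Series.

(* exp(A) = sum_m A^m / m! on families (f i), i in I, evaluated index by index.
   The finitely supported sum \sum_(m \in setT) is 0 if infinitely many terms
   are nonzero; for every exponential formed below, at the argument it is
   applied to, only finitely many terms are nonzero at each index. *)
Definition exp_op (F : fieldType) (V : lmodType F) (I : Type)
    (A : (I -> V) -> (I -> V)) (f : I -> V) : I -> V :=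
  fun i => \sum_(m \in [set: nat]) (m`!%:R)^-1 *: iter m A f i.

(* exp of a matrix power series without constant term; the powers j > n do not
   contribute to the coefficient of z^n. *)
Definition mexp (F : fieldType) (N : nat) (r : nat -> 'M[F]_N) : nat -> 'M[F]_N :=
  fun n => \sum_(j < n.+1) (j`!%:R)^-1 *: spow r j n.

Section Polynomials.

Variables (F : fieldType) (I : choiceType).

Local Notation P := {malg F[{cmonom I}]}.

Definition tvar (i : I) : P := << ucm i >>.

Definition pderiv (i : I) (p : P) : P :=
  \sum_(m <- msupp p) << (p@_m *+ m i) *g divcm m (ucm i) >>.

(* A family of variables T_k = tvar (x k) is given by x : nat -> I. *)
Variable x : nat -> I.

(* d/dT_l, which is 0 for l < 0. *)
Definition dT (l : int) (p : P) : P :=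
  if l is Posz n then pderiv (x n) p else 0.

(* Since i, j >= 0, i + j = - m - 1 or i + j = m - 1 forces i, j < |m|. *)
Definition Lvir (m : int) (p : P) : P :=
  2%:R^-1 *: (\sum_(i < `|m|%N) \sum_(j < `|m|%N | i%:Z + j%:Z == - m - 1)
    (dfact i * dfact j)%:R^-1 *: (tvar (x i) * tvar (x j) * p))
  + \sum_(k \in [set: nat])
      ((dfact (absz (k%:Z + m + 1)))%:R / (dfact k)%:R)
        *: (tvar (x k) * dT (k%:Z + m) p)
  + 2%:R^-1 *: (\sum_(i < `|m|%N) \sum_(j < `|m|%N | i%:Z + j%:Z == m - 1)
    (dfact i.+1 * dfact j.+1)%:R *: dT i%:Z (dT j%:Z p)).

Definition subst_vars (p : {malg F[{cmonom nat}]}) : P :=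
  mmap (fun c : F => c%:MP) (fun m : {cmonom nat} =>
    \prod_(k <- finsupp m) tvar (x k) ^+ m k) p.

End Polynomials.

(* An element of C[T][[hbar]] is the sequence nat -> C[T] of its coefficients.
   Applying That brings in all powers of 1/hbar, so the operators act on
   sequences int -> C[T], the value at e being the coefficient of hbar^e. *)
Definition laurent (V : nmodType) (f : nat -> V) : int -> V :=
  fun e => if e is Posz n then f n else 0.

Definition hlift (V : Type) (A : V -> V) (f : int -> V) : int -> V :=
  fun e => A (f e).

Definition hbar_ddhbar (F : fieldType) (V : lmodType F) (f : int -> V) : int -> V :=
  fun e => e%:~R *: f e.

(* (L_k / 2 - (2k + 2 alpha + 1)!! / (2 hbar) d/dT_{k + alpha}
     + delta_{k,0} / 16) tau = 0 for k >= - alpha, at each power hbar^e;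
   alpha = 1 is Kontsevich--Witten and alpha = 0 Brezin--Gross--Witten. *)
Definition is_tau (F : fieldType) (alpha : nat)
    (tau : nat -> {malg F[{cmonom nat}]}) : Prop :=
  (forall n, (tau n)@_(@onecm nat) = (n == 0%N)%:R) /\
  (forall k : int, - alpha%:Z <= k -> forall e : int,
     2%:R^-1 *: Lvir id k (laurent tau e)
     - ((dfact (absz (k + alpha%:Z + 1)))%:R / 2%:R)
         *: dT id (k + alpha%:Z) (laurent tau (e + 1))
     + ((k == 0)%:R / 16%:R) *: laurent tau e = 0).

Section Operators.

Variables (F : fieldType) (N : nat).

Local Notation CT := {malg F[{cmonom ('I_N * nat)%type}]}.
Local Notation hser := (int -> CT).

(* T^a_k is the variable of index (a, k). *)
Definition fam (a : 'I_N) : nat -> 'I_N * nat := fun k => (a, k).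

(* With r_k e_a = \sum_b (r_k)^b_a e_b, both (r_k)^b_a and
   (r_k)^{ab} = (r_k)_a^b are the matrix entry r k b a. *)
Definition rop (r : nat -> 'M[F]_N) (p : CT) : CT :=
  \sum_(k \in [set k : nat | (0 < k)%N]) \sum_(a < N) \sum_(b < N)
    (\sum_(j \in [set: nat])
        r k b a *: (tvar F (a, j) * pderiv (b, (k + j)%N) p)
     + 2%:R^-1 *: \sum_(j < k)
        ((-1) ^+ j.+1 * r k b a) *: pderiv (a, j : nat) (pderiv (b, (k - j - 1)%N) p)).

Definition Rhat (r : nat -> 'M[F]_N) : hser -> hser :=
  exp_op (hlift (rop r)).

(* rop r strictly lowers the grading in which T^a_k has degree k + 1, so it is
   locally nilpotent on C[T] and exp(- rop r) inverts exp(rop r); likewise for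
   vop below, with T^a_k of degree 2k + 1. *)
Definition Rhat_inv (r : nat -> 'M[F]_N) : hser -> hser :=
  exp_op (hlift (fun p => - rop r p)).

Definition That (DT : 'I_N -> nat -> F) : hser -> hser :=
  exp_op (fun f e => \sum_(k \in [set k : nat | (0 < k)%N]) \sum_(a < N)
    DT a k *: pderiv (a, k) (f (e + 1))).

(* prod_a tau_{alpha_a}(hbar * s_a, T^a), where s_a is the chosen square root
   of Delta_a. *)
Definition Dhat_prod_tau (s : 'I_N -> F) (alpha : 'I_N -> 'I_2)
    (tau : 'I_2 -> nat -> {malg F[{cmonom nat}]}) : hser :=
  laurent (\big[@smul CT/@sone CT]_(a < N)
    (fun n => s a ^+ n *: subst_vars (fam a) (tau (alpha a) n))).

Definition vop (c : nat -> F) (a : 'I_N) (p : CT) : CT :=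
  \sum_(k \in [set k : nat | (0 < k)%N]) c k *: Lvir (fam a) k%:Z p.

Definition Vhat (chi : 'I_N -> nat -> F) : hser -> hser :=
  \big[(fun A B => A \o B)/id]_(a < N) exp_op (hlift (vop (chi a) a)).

(* The factors of Vhat for different a commute. *)
Definition Vhat_inv (chi : 'I_N -> nat -> F) : hser -> hser :=
  \big[(fun A B => A \o B)/id]_(a < N)
    exp_op (hlift (fun p => - vop (chi a) a p)).

Definition L0sum (alpha : 'I_N -> 'I_2) : hser -> hser :=
  hlift (fun p => \sum_(a < N) (alpha a).*2.+1%:R^-1 *: Lvir (fam a) 0 p).

Definition Zpot (r : nat -> 'M[F]_N) (DT : 'I_N -> nat -> F) (s : 'I_N -> F)
    (alpha : 'I_N -> 'I_2) (tau : 'I_2 -> nat -> {malg F[{cmonom nat}]}) : hser :=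
  Rhat r (That DT (Dhat_prod_tau s alpha tau)).

Definition Hhat (r : nat -> 'M[F]_N) (chi : 'I_N -> nat -> F)
    (alpha : 'I_N -> 'I_2) : hser -> hser :=
  Rhat r \o Vhat chi \o L0sum alpha \o Vhat_inv chi \o Rhat_inv r.

End Operators.

Section Reparametrization.

Variable F : fieldType.

(* v(z) = s * \sum_(k >= 1 + alpha) DT_k / (2k + 1)!! z^(2k + 1). *)
Definition vser (s : F) (alpha : nat) (DT : nat -> F) : nat -> F :=
  fun n => if odd n && (alpha < n./2)%N
           then s * DT n./2 / (dfact n./2.+1)%:R else 0.

Definition gbinom (c : F) (j : nat) : F := (\prod_(i < j) (c - i%:R)) / j`!%:R.

(* (1 + x)^c by the binomial series, for x without constant term. *)
Definition spow1p (x : nat -> F) (c : F) : nat -> F :=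
  fun n => \sum_(j < n.+1) gbinom c j * spow x j n.

(* f(z) = z (1 - (2 alpha + 1) v(z) / z^(2 alpha + 1))^(1 / (2 alpha + 1)). *)
Definition fser (s : F) (alpha : nat) (DT : nat -> F) : nat -> F :=
  fun n => if n is n'.+1 then
    spow1p (fun i => - (alpha.*2.+1%:R * vser s alpha DT (i + alpha.*2.+1)%N))
      alpha.*2.+1%:R^-1 n'
  else 0.

Definition sderiv (g : nat -> F) : nat -> F := fun n => n.+1%:R * g n.+1.

(* \sum_(k >= 1) chi_k z^(2k + 1). *)
Definition chiser (chi : nat -> F) : nat -> F :=
  fun n => if odd n && (1 < n)%N then chi n./2 else 0.

Definition exp_field (chi : nat -> F) : (nat -> F^o) -> (nat -> F^o) :=
  exp_op (fun (g : nat -> F^o) n => - smul (chiser chi) (sderiv g) n : F^o).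

Definition zser : nat -> F^o := fun n => (n == 1%N)%:R.

End Reparametrization.

(* Main.v *)
(* Write Phi for the product of the tau-functions at hbar s_a, and give T^a_k
   the weight (2k + 1) / (2 alpha_a + 1).  The Virasoro constraints determine all
   derivatives of the hbar^(e+1) coefficient of a tau-function by its hbar^e
   coefficient, so by induction the hbar^e coefficient of Phi is homogeneous of
   weight e; this is the theorem for Phi itself: hbar d/dhbar Phi =
   \sum_a L_0^a / (2 alpha_a + 1) Phi.

   As R and V act coefficientwise in hbar, everything reduces to V Phi = That Phi.
   Put A = \sum_a \sum_k chi^a_k L_k^a.  The constraints say A Phi = D_1 Phi with
   D_1 a combination of the d/dT / hbar, and [A, -] preserves the span of these,
   acting as the vector field X = - \sum_k chi_k z^(2k+1) d/dz once (2k + 1)!! d/dT_k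
   is identified with z^(2k+1).  Hence exp(t A) Phi = exp(\sum_n t^n D_n) Phi with
   D_n = ad_A^(n-1) D_1 / n!; the coefficient of t^m involves the operators [eps].
   In the identification D_1 is - X z^d / (d s) with d = 2 alpha + 1, so
   \sum_n D_n = (z^d - (exp(X) z)^d) / (d s) = (z^d - f^d) / (d s) = v / s,
   which is the exponent of That.  All sums are finite because each D_n lowers
   the weight of a coefficient by more than the shift of hbar raises it. *)
Require Import Defs.
From HB Require Import structures.
From mathcomp Require Import all_boot all_order all_algebra.
From mathcomp Require Import finmap.
From mathcomp Require Import mathcomp_extra boolp classical_sets fsbigop.
From mathcomp.multinomials Require Import monalg.
From mathcomp.real_closed Require Import complex.
From mathcomp Require Import reals.
From mathcomp Require Import zify ring.

Set Implicit Arguments.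
Unset Strict Implicit.
Unset Printing Implicit Defensive.

Import Order.TTheory GRing.Theory Num.Theory.
Local Open Scope ring_scope.

(** The finitely supported sums in the operators take the value 0 when infinitely many terms
    survive, so an exponential can be manipulated only once local finiteness is known; the
    filtrations by weight serve this. No single weight serves both groups. The coefficients of Phi
    are homogeneous for the weight 3 (2k + 1) / (2 alpha_a + 1), the factor 3 making it integral,
    but then a term T^a_j d/dT^b_(j+k) of R with alpha_a = 0 and alpha_b = 1 raises the weight for
    large j. Hence polynomials carry two filtrations, R being treated with weight 2k + 1 in every
    family. The value Delta_a = 0 is allowed although D_1 contains 1 / s_a. In that case the a-th
    factor of Phi is constant, so derivatives in T^a kill it, and 0^-1 = 0 yields identities with
    s_a / s_a in place of 1. Since A does not commute with the D_n, the exponentials are compared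
    one power of t at a time, where only the commutators of A with the D_n enter; t = 1 is set at
    the end, once finitely many powers contribute. *)

(** * Truncation and regrouping of finitely supported sums *)

Section Sums.

Variable V : nmodType.

Lemma fsum_trunc (G : nat -> V) K : (forall k, (K <= k)%N -> G k = 0) ->
  \sum_(k \in [set: nat]) G k = \sum_(k < K) G k.
Proof.
move=> G0; rewrite fsbig_ord; apply/esym/fsbig_widen => // k [_ /= /negP].
by rewrite -leqNgt => /G0.
Qed.

Lemma fsum_pos_trunc (G : nat -> V) K : (forall k, (K <= k)%N -> G k = 0) ->
  \sum_(k \in [set k : nat | (0 < k)%N]) G k = \sum_(k < K | (0 < k)%N) G k.
Proof.
move=> G0; rewrite [RHS]big_mkcond/=.
rewrite -(@fsum_trunc (fun k => if (0 < k)%N then G k else 0)); last first.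
  by move=> k /G0 ->; rewrite if_same.
rewrite fsbig_mkcond; apply: eq_fsbigr => k _; rewrite /functions.patch.
by rewrite mem_setE.
Qed.

(** The corner i + j >= K of the square contributes nothing, so a product of two truncated series
    can be regrouped along antidiagonals. *)
Lemma tri_sum K (G : nat -> nat -> V) :
  (forall i j, (K <= i + j)%N -> G i j = 0) ->
  \sum_(i < K) \sum_(j < K) G i j = \sum_(n < K) \sum_(i < n.+1) G i (n - i)%N.
Proof.
move=> G0.
transitivity (\sum_(n < K) \sum_(i < K | (i <= n)%N) G i (n - i)%N); last first.
  apply: eq_bigr => n _; rewrite -(big_mkord (fun i => i <= n)%N (fun i => G i (n - i)%N)).
  rewrite -(big_mkord xpredT (fun i => G i (n - i)%N)).
  rewrite (big_nat_widen 0 n.+1 K) //.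
rewrite [RHS](exchange_big_dep xpredT) //=; apply: eq_bigr => i _.
transitivity (\sum_(0 <= n < K | (i <= n)%N) G i (n - i)%N); last by rewrite big_mkord.
rewrite -(big_mkord xpredT (G i)).
have iK : (i <= K)%N by apply: ltnW.
rewrite [RHS](big_cat_nat _ iK)//= [X in _ = X + _]big_nat_cond [X in _ = X + _]big1 ?add0r; last first.
  by move=> n /andP[/andP[_ ni]]; rewrite leqNgt ni.
have -> : \sum_(i <= n < K | (i <= n)%N) G i (n - i)%N = \sum_(0 <= j < K - i) G i j.
  rewrite -{1}(add0n i) big_addn [LHS]big_mkcond/=; apply: eq_bigr => j _.
  by rewrite leq_addl addnK.
rewrite (@big_cat_nat _ _ _ (K - i)%N) ?leq_subr//=.
rewrite [X in _ + X]big_nat_cond [X in _ + X]big1 ?addr0// => j /andP[/andP[jK _] _].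
by apply: G0; rewrite -leq_subLR.
Qed.

End Sums.

(** * Linear maps given as plain functions, and commuting operators *)

Section LinearMaps.

Variables (F : fieldType) (U V : lmodType F).
Implicit Types (A : U -> V) (c : F).

Lemma linop0 A : linear A -> A 0 = 0.
Proof. by move=> lA; have := lA (-1) 0 0; rewrite scaler0 addr0 scaleN1r addNr. Qed.

Lemma linopD A : linear A -> {morph A : p q / p + q}.
Proof. by move=> lA p q; have := lA 1 p q; rewrite !scale1r. Qed.

Lemma linopZ A : linear A -> forall c, {morph A : p / c *: p}.
Proof. by move=> lA c p; have := lA c p 0; rewrite (linop0 lA) !addr0. Qed.

Lemma linopN A : linear A -> {morph A : p / - p}.
Proof. by move=> lA p; rewrite -!scaleN1r (linopZ lA). Qed.

Lemma linop_sum A : linear A -> forall (J : Type) (s : seq J) (P : pred J) (G : J -> U),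
  A (\sum_(j <- s | P j) G j) = \sum_(j <- s | P j) A (G j).
Proof. by move=> lA J s P G; apply: big_morph; [exact: linopD|exact: linop0]. Qed.

Lemma linop_comp (W : lmodType F) A (B : W -> U) :
  linear A -> linear B -> linear (fun p => A (B p)).
Proof. by move=> lA lB c p q; rewrite lB lA. Qed.

End LinearMaps.

Section LinearEndomorphisms.

Variables (F : fieldType) (V : lmodType F).
Implicit Types (A B : V -> V) (c : F) (p q : V).

Lemma linop_add A B : linear A -> linear B -> linear (fun p => A p + B p).
Proof. by move=> lA lB c p q; rewrite lA lB scalerDr addrACA. Qed.

Lemma linop_scale A c : linear A -> linear (fun p => c *: A p).
Proof. by move=> lA d p q; rewrite lA scalerDr !scalerA mulrC. Qed.

Lemma linop_bigsum (J : Type) (s : seq J) (P : pred J) (G : J -> V -> V) :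
  (forall j, P j -> linear (G j)) -> linear (fun p => \sum_(j <- s | P j) G j p).
Proof.
move=> lG c p q; rewrite scaler_sumr -big_split/=.
by apply: eq_bigr => j Pj; rewrite lG.
Qed.

Definition commutes A B := forall p, A (B p) = B (A p).

Lemma commutes_sym A B : commutes A B -> commutes B A.
Proof. by move=> c p; rewrite c. Qed.

Lemma commutes_iter A B m : commutes A B -> commutes (iter m A) B.
Proof. by move=> cAB p; elim: m => //= m ->. Qed.

Lemma commutes_comp A B C : commutes A B -> commutes A C -> commutes A (fun p => B (C p)).
Proof. by move=> cB cC p; rewrite cB cC. Qed.

Lemma commutes_add A B C : linear A ->
  commutes A B -> commutes A C -> commutes A (fun p => B p + C p).
Proof. by move=> lA cB cC p; rewrite (linopD lA) cB cC. Qed.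

Lemma commutes_scale A B c : linear A -> commutes A B -> commutes A (fun p => c *: B p).
Proof. by move=> lA cB p; rewrite (linopZ lA) cB. Qed.

Lemma commutes_opp A B : linear A -> linear B ->
  commutes A B -> commutes (fun p => - A p) (fun p => - B p).
Proof. by move=> lA lB cAB p; rewrite (linopN lA) (linopN lB) cAB. Qed.

Lemma commutes_sum A (J : Type) (s : seq J) (P : pred J) (G : J -> V -> V) :
  linear A -> (forall j, P j -> commutes A (G j)) ->
  commutes A (fun p => \sum_(j <- s | P j) G j p).
Proof. by move=> lA cG p; rewrite (linop_sum lA); apply: eq_bigr => j /cG ->. Qed.

Lemma linop_iter A m : linear A -> linear (iter m A).
Proof. by move=> lA; elim: m => // m IH c p q; rewrite !iterS IH lA. Qed.

Lemma iterD_commutes A B n p : linear A -> linear B -> commutes A B ->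
  iter n (fun q => A q + B q) p
  = \sum_(i < n.+1) 'C(n, i)%:R *: iter i A (iter (n - i) B p).
Proof.
move=> lA lB cAB; elim: n => [|n IH].
  by rewrite big_ord_recl big_ord0 /= bin0 scale1r addr0.
rewrite iterS {}IH /=; set S := \sum_(i < _) _.
(* Both sums are padded to n + 2 terms, so that Pascal's rule applies termwise. *)
have -> : A S = \sum_(i < n.+2)
    (if (i : nat) is i'.+1 then 'C(n, i')%:R else 0) *: iter i A (iter (n.+1 - i) B p).
  rewrite (linop_sum lA) [RHS]big_ord_recl/= scale0r add0r.
  by apply: eq_bigr => i _; rewrite (linopZ lA) /bump/= add1n subSS.
have -> : B S = \sum_(i < n.+2) 'C(n, i)%:R *: iter i A (iter (n.+1 - i) B p).
  rewrite (linop_sum lB) [RHS]big_ord_recr/= bin_small// scale0r addr0.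
  apply: eq_bigr => i _.
  by rewrite (linopZ lB) -(commutes_iter _ cAB) -iterS -subSn// -ltnS.
rewrite -big_split/=; apply: eq_bigr => -[[|i] /= _] _.
  by rewrite scale0r add0r !bin0.
by rewrite -scalerDl -natrD addnC -binS.
Qed.

End LinearEndomorphisms.

(** * Filtered modules and exponentials of lowering operators *)

(* Increasing exhaustive separated filtrations, [below n] playing the role of
   the polynomials all of whose monomials have weight less than [n]. *)
Record filtered (F : fieldType) := Filtered {
  carrier :> lmodType F;
  below : int -> carrier -> Prop;
  below_lin : forall n c p q, below n p -> below n q -> below n (c *: p + q);
  below_le : forall n n' p, n <= n' -> below n p -> below n' p;
  below_eq0 : forall n p, n <= 0 -> below n p -> p = 0;
  below0 : forall n, below n 0;
  exists_below : forall p, exists n : nat, below n%:Z p }.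

Section Filtered.

Variables (F : numFieldType) (P : filtered F).
Implicit Types (p q : P).

Local Notation below := (@below F P).

Lemma belowD n p q : below n p -> below n q -> below n (p + q).
Proof. by move=> np nq; rewrite -[p]scale1r; apply: below_lin. Qed.

Lemma belowZ n c p : below n p -> below n (c *: p).
Proof. by move=> np; rewrite -[_ *: _]addr0; apply: below_lin => //; exact: below0. Qed.

Lemma below_sum n (J : Type) (s : seq J) (T : pred J) (G : J -> P) :
  (forall j, T j -> below n (G j)) -> below n (\sum_(j <- s | T j) G j).
Proof. by move=> h; elim/big_rec : _ => [|j x Tj]; [exact: below0|apply: belowD; exact: h]. Qed.

(** A negative [l] is meaningful: multiplication by a variable raises the weight. *)
Definition lowers (l : int) (A : P -> P) :=
  linear A /\ forall n p, below n p -> below (n - l) (A p).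

Lemma lowersW l l' A : l' <= l -> lowers l A -> lowers l' A.
Proof. by move=> ll' [lA hA]; split=> // n p /hA; apply: below_le; rewrite lerB. Qed.

Lemma lowers_id : lowers 0 id.
Proof. by split=> // n p; rewrite subr0. Qed.

Lemma lowers0 l : lowers l (fun=> 0).
Proof. by split=> [c p q|n p _]; [rewrite scaler0 addr0|exact: below0]. Qed.

Lemma lowersD l A B : lowers l A -> lowers l B -> lowers l (fun p => A p + B p).
Proof.
move=> [lA hA] [lB hB]; split; first exact: linop_add.
by move=> n p h; apply: belowD; [exact: hA|exact: hB].
Qed.

Lemma lowersZ l c A : lowers l A -> lowers l (fun p => c *: A p).
Proof.
move=> [lA hA]; split; first exact: linop_scale.
by move=> n p h; apply: belowZ; exact: hA.
Qed.

Lemma lowersN l A : lowers l A -> lowers l (fun p => - A p).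
Proof. by move/(lowersZ (-1)); rewrite (_ : (fun p => _) = fun p => - A p)//; apply/funext => p; rewrite scaleN1r. Qed.

Lemma lowers_comp l l' A B : lowers l A -> lowers l' B -> lowers (l + l') (fun p => A (B p)).
Proof.
move=> [lA hA] [lB hB]; split; first exact: linop_comp.
by move=> n p /hB/hA; rewrite opprD addrA addrAC.
Qed.

Lemma lowers_sum l (J : Type) (s : seq J) (T : pred J) (G : J -> P -> P) :
  (forall j, T j -> lowers l (G j)) -> lowers l (fun p => \sum_(j <- s | T j) G j p).
Proof.
move=> h; split; first by apply: linop_bigsum => j /h[].
by move=> n p b; apply: below_sum => j /h[_]; exact.
Qed.

Lemma lowers_iter l A m : lowers l A -> lowers (l *+ m) (iter m A).
Proof.
move=> h; elim: m => [|m IH]; first exact: lowers_id.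
by rewrite mulrS; exact: lowers_comp h IH.
Qed.

(** The index of the term is compared with the weight itself, so a bound on the weight of [p] is at
    once a truncation point for the sum. *)
Definition locfin (G : nat -> P -> P) := forall (k : nat) p, below k%:Z p -> G k p = 0.

Lemma locfin_fsum G (K : nat) p : locfin G -> below K p ->
  \sum_(k \in [set: nat]) G k p = \sum_(k < K) G k p.
Proof. by move=> lG b; apply: fsum_trunc => k Kk; apply: lG; apply: below_le b. Qed.

Lemma locfin_fsum_pos G (K : nat) p : locfin G -> below K p ->
  \sum_(k \in [set k : nat | (0 < k)%N]) G k p = \sum_(k < K | (0 < k)%N) G k p.
Proof. by move=> lG b; apply: fsum_pos_trunc => k Kk; apply: lG; apply: below_le b. Qed.

Lemma locfin_lowers G : (forall k : nat, lowers k%:Z (G k)) -> locfin G.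
Proof.
move=> h k p b; have [_ hG] := h k; apply: (@below_eq0 _ P (k%:Z - k%:Z)); last exact: hG.
by rewrite subrr.
Qed.

Lemma exists_below2 p q : exists n : nat, below n p /\ below n q.
Proof.
have [n bp] := exists_below p; have [m bq] := exists_below q.
exists (n + m)%N; split; [apply: below_le bp|apply: below_le bq];
by rewrite lez_nat ?leq_addr ?leq_addl.
Qed.

Lemma lowers_fsum l G : locfin G -> (forall k, lowers l (G k)) ->
  lowers l (fun p => \sum_(k \in [set: nat]) G k p).
Proof.
move=> lG hG; split=> [c p q|n p b].
  have [K [bp bq]] := exists_below2 p q.
  rewrite !(@locfin_fsum _ K)//; last exact: below_lin.
  by apply: (@linop_bigsum _ _ _ _ _ (fun k : 'I_K => G k)) => k _; have [] := hG k.
have [K bp] := exists_below p; rewrite (@locfin_fsum _ K)//.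
by apply: (@below_sum _ _ _ _ (fun k : 'I_K => G k p)) => k _; have [_] := hG k; exact.
Qed.

Lemma lowers_fsum_pos l G : locfin G -> (forall k, (0 < k)%N -> lowers l (G k)) ->
  lowers l (fun p => \sum_(k \in [set k : nat | (0 < k)%N]) G k p).
Proof.
move=> lG hG; split=> [c p q|n p b].
  have [K [bp bq]] := exists_below2 p q.
  rewrite !(@locfin_fsum_pos _ K)//; last exact: below_lin.
  by apply: (@linop_bigsum _ _ _ _ _ (fun k : 'I_K => G k)) => k k0; have [] := hG k k0.
have [K bp] := exists_below p; rewrite (@locfin_fsum_pos _ K)//.
by apply: (@below_sum _ _ _ _ (fun k : 'I_K => G k p)) => k k0; have [_] := hG k k0; exact.
Qed.

Lemma commutes_fsum A G : lowers 0 A -> locfin G -> (forall k, commutes A (G k)) ->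
  commutes A (fun p => \sum_(k \in [set: nat]) G k p).
Proof.
move=> [lA hA] lG cG p; have [K bp] := exists_below p.
rewrite !(@locfin_fsum _ K)//; last by have := hA _ _ bp; rewrite subr0.
by apply: (@commutes_sum _ _ A _ _ _ (fun k : 'I_K => G k)).
Qed.

Lemma commutes_fsum_pos A G : lowers 0 A -> locfin G ->
  (forall k, (0 < k)%N -> commutes A (G k)) ->
  commutes A (fun p => \sum_(k \in [set k : nat | (0 < k)%N]) G k p).
Proof.
move=> [lA hA] lG cG p; have [K bp] := exists_below p.
rewrite !(@locfin_fsum_pos _ K)//; last by have := hA _ _ bp; rewrite subr0.
by apply: (@commutes_sum _ _ A _ _ _ (fun k : 'I_K => G k)) => // k; exact: cG.
Qed.

(** The exponential at a single coefficient, without the index family of [exp_op]. *)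
Definition pexp (A : P -> P) p : P :=
  \sum_(m \in [set: nat]) (m`!%:R)^-1 *: iter m A p.

Lemma locfin_pexp A : lowers 1 A -> locfin (fun m p => (m`!%:R)^-1 *: iter m A p).
Proof.
move=> h; apply: locfin_lowers => m; apply: lowersZ.
by have := lowers_iter m h; rewrite natz.
Qed.

Lemma pexpE A (K : nat) p : lowers 1 A -> below K p ->
  pexp A p = \sum_(m < K) (m`!%:R)^-1 *: iter m A p.
Proof. by move=> h; exact: (locfin_fsum (locfin_pexp h)). Qed.

Lemma lowers_pexp A : lowers 1 A -> lowers 0 (pexp A).
Proof.
move=> h; apply: lowers_fsum; first exact: locfin_pexp.
move=> k; apply: lowersZ; have := lowers_iter k h; apply: lowersW.
by rewrite natz.
Qed.

(** Cauchy product of the two exponentials. Below weight K both are sums of K terms, and i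
    applications of [A] after j of [B] give zero once i + j >= K, which is what the triangular
    regrouping requires. *)
Lemma pexp_add A B p : lowers 1 A -> lowers 1 B -> commutes A B ->
  pexp A (pexp B p) = pexp (fun q => A q + B q) p.
Proof.
move=> hA hB cAB; have [K bp] := exists_below p.
have bB : below K (pexp B p) by have := (lowers_pexp hB).2 _ _ bp; rewrite subr0.
rewrite (pexpE hA bB) (pexpE (lowersD hA hB) bp).
have lA i : linear (iter i A) by apply: linop_iter; case: hA.
have lB i : linear (iter i B) by apply: linop_iter; case: hB.
pose G i j := (i`!%:R)^-1 *: ((j`!%:R)^-1 *: iter i A (iter j B p)).
transitivity (\sum_(i < K) \sum_(j < K) G i j).
  apply: eq_bigr => i _; rewrite (pexpE hB bp) (linop_sum (lA i)) scaler_sumr.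
  by apply: eq_bigr => j _; rewrite (linopZ (lA i)).
rewrite tri_sum => [|i j ij].
  apply: eq_bigr => n _; rewrite (iterD_commutes _ _ hA.1 hB.1 cAB) scaler_sumr.
  apply: eq_bigr => i _; rewrite /G !scalerA; congr (_ *: _).
  have /(congr1 (fun k => k%:R : F)) := bin_fact (ltn_ord i : (i <= n)%N).
  rewrite !natrM => e.
  have f0 k : (k`!%:R : F) != 0 by rewrite pnatr_eq0 -lt0n fact_gt0.
  have C0 : ('C(n, i)%:R : F) != 0 by rewrite pnatr_eq0 -lt0n bin_gt0 -ltnS.
  by rewrite -e; field; rewrite C0 !f0.
rewrite /G; have [_ h] := lowers_comp (lowers_iter i hA) (lowers_iter j hB).
rewrite (_ : iter i A (iter j B p) = 0) ?scaler0//.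
by apply: below_eq0 (h _ _ bp); rewrite !natz; lia.
Qed.

Lemma pexp0 p : pexp (fun=> 0) p = p.
Proof.
rewrite /pexp (@fsum_trunc _ _ 1) => [|[|k] //= _]; last by rewrite scaler0.
by rewrite big_ord1 /= invr1 scale1r.
Qed.

Lemma pexpN A p : lowers 1 A -> pexp (fun q => - A q) (pexp A p) = p.
Proof.
move=> h; rewrite pexp_add//; first last.
- by move=> q; rewrite (linopN h.1).
- exact: lowersN.
rewrite (_ : (fun q => _) = fun=> 0) ?pexp0//.
by apply/funext => q; rewrite addNr.
Qed.

End Filtered.

(** * Virasoro operators on a Weyl module *)

(** Collapses an ordered product of exponentials, as in [Vhat], into one exponential. *)
Lemma bigcomp_pexp (F : numFieldType) (P : filtered F) (J : Type) (s : seq J)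
    (B : J -> P -> P) (p : P) :
  (forall a, lowers 1 (B a)) -> (forall a b, commutes (B a) (B b)) ->
  (\big[(fun f g => f \o g)/id]_(a <- s) pexp (B a)) p
  = pexp (fun q => \sum_(a <- s) B a q) p.
Proof.
move=> hB cB; elim: s p => [|a s IH] p.
  rewrite big_nil (_ : (fun q => _) = fun=> 0) ?pexp0//.
  by apply/funext => q; rewrite big_nil.
rewrite big_cons /= IH pexp_add//.
- by congr pexp; apply/funext => q; rewrite big_cons.
- exact: lowers_sum.
- by apply: commutes_sum => //; case: (hB a).
Qed.

Definition vwt (N : nat) (wa : 'I_N -> nat) (i : 'I_N * nat) : nat :=
  (wa i.1 * i.2.*2.+1)%N.

(* [pd (a, k)] stands for d/dT^a_k and [tm (a, k)] for the multiplication by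
   T^a_k, which has weight [wa a * (2 k + 1)]. *)
Record weyl (F : numFieldType) (N : nat) (wa : 'I_N -> nat) := Weyl {
  wmod :> filtered F;
  pd : 'I_N * nat -> wmod -> wmod;
  tm : 'I_N * nat -> wmod -> wmod;
  lowers_pd : forall i, lowers (vwt wa i)%:Z (pd i);
  lowers_tm : forall i, lowers (- (vwt wa i)%:Z) (tm i);
  pdC : forall i j, commutes (pd i) (pd j);
  tmC : forall i j, commutes (tm i) (tm j);
  pd_tm : forall i j p, pd i (tm j p) = (i == j)%:R *: p + tm j (pd i p) }.

Section Weyl.

Variables (F : numFieldType) (N : nat) (wa : 'I_N -> nat) (W : weyl F wa).
Hypothesis wa_gt0 : forall a, (0 < wa a)%N.

Implicit Types (p q : W) (a b : 'I_N) (k l : nat) (c : 'I_N -> nat -> F).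

Lemma le_vwt a k : (k.*2.+1 <= vwt wa (a, k))%N.
Proof. by rewrite /vwt /= leq_pmull. Qed.

Lemma pd_eq0 a k n p : n <= k.*2.+1%:Z -> below n p -> pd (a, k) p = 0.
Proof.
move=> nk b; have := (lowers_pd W (a, k)).2 _ _ b; apply: below_eq0.
by have := le_vwt a k; lia.
Qed.

Lemma linear_pd i : linear (@pd _ _ _ W i). Proof. by case: (lowers_pd W i). Qed.
Lemma linear_tm i : linear (@tm _ _ _ W i). Proof. by case: (lowers_tm W i). Qed.

Lemma commutes_pd_tm i j : i != j -> commutes (@pd _ _ _ W i) (@tm _ _ _ W j).
Proof. by move=> /negPf ij p; rewrite pd_tm ij scale0r add0r. Qed.

(** This is (2l + 2k + 1)!! / (2l - 1)!!, the factor of T_l d/dT_(l+k) in L_k. *)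
Definition Lcoef k l : F := (dfact (l + k + 1))%:R / (dfact l)%:R.

(** The form of [Lvir] at nonnegative index, where the T_i T_j part is empty; only the Weyl
    relations and weights are available here. *)
Definition Lv a k p : W :=
  \sum_(j \in [set: nat]) Lcoef k j *: tm (a, j) (pd (a, (j + k)%N) p)
  + 2%:R^-1 *: (\sum_(i < k) \sum_(j < k | i%:Z + j%:Z == k%:Z - 1)
      (dfact i.+1 * dfact j.+1)%:R *: pd (a, nat_of_ord i) (pd (a, nat_of_ord j) p)).

Lemma lowers_tmpd a b j k :
  lowers ((vwt wa (b, k))%:Z - (vwt wa (a, j))%:Z) (fun p => tm (a, j) (pd (b, k) p) : W).
Proof. by rewrite addrC; apply: lowers_comp; [exact: lowers_tm|exact: lowers_pd]. Qed.

Lemma locfin_L1 a k :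
  locfin (fun j p => Lcoef k j *: tm (a, j) (pd (a, (j + k)%N) p) : W).
Proof.
move=> j p bp; rewrite (@pd_eq0 _ _ j%:Z)//; last by lia.
by rewrite (linop0 (linear_tm _)) scaler0.
Qed.

(** Each term lowers the weight by 2 k [wa a]; the weaker bound 2k is uniform in [a]. *)
Lemma lowers_Lv a k : lowers k.*2%:Z (Lv a k).
Proof.
have wk := wa_gt0 a; apply: lowersD.
  apply: lowers_fsum => [|j]; first exact: locfin_L1.
  apply: lowersZ; apply: lowersW (lowers_tmpd _ _ _ _).
  by rewrite /vwt /=; nia.
apply: lowersZ; apply: lowers_sum => i _; apply: lowers_sum => j /eqP ij.
apply: lowersZ; apply: lowersW (lowers_comp (lowers_pd _ _) (lowers_pd _ _)).
by rewrite /vwt /=; nia.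
Qed.

(** The infinite sum is cut at a common bound for [p] and [B p], so [B] may raise weights; this
    covers multiplication by a polynomial in the other families. *)
Lemma Lv_commutes (B : W -> W) a k : linear B ->
  (forall i, commutes B (pd (a, i))) -> (forall i, commutes B (tm (a, i))) ->
  commutes B (Lv a k).
Proof.
move=> lB cBp cBt; apply: commutes_add => //.
  move=> p; have [K [bp bq]] := exists_below2 p (B p).
  rewrite !(locfin_fsum (@locfin_L1 _ _) (K := K))//.
  apply: (@commutes_sum _ _ B _ _ _ (fun j : 'I_K => fun p => Lcoef k j *: tm (a, nat_of_ord j) (pd (a, (j + k)%N) p))) => // j _.
  by apply: commutes_scale => //; apply: commutes_comp.
apply: commutes_scale => //; apply: commutes_sum => // i _.
apply: commutes_sum => // j _; apply: commutes_scale => //.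
by apply: commutes_comp; apply: cBp.
Qed.

Lemma commutes_Lv a b k l : a != b -> commutes (Lv a k) (Lv b l).
Proof.
move=> ab; have ne i j : (a, i) != (b, j) by rewrite xpair_eqE (negPf ab).
have ne' i j : (b, i) != (a, j) by rewrite xpair_eqE eq_sym (negPf ab).
apply: Lv_commutes => [|i|i]; first by case: (lowers_Lv a k).
  apply: commutes_sym; apply: Lv_commutes => [|j|j]; first exact: linear_pd.
    exact: pdC.
  exact: commutes_pd_tm.
apply: commutes_sym; apply: Lv_commutes => [|j|j]; first exact: linear_tm.
  by apply: commutes_sym; exact: commutes_pd_tm.
exact: tmC.
Qed.

(** In the first sum only T_l d/dT_(l+k) fails to commute with d/dT_l, and the second-order part has
    constant coefficients. *)
Lemma Lv_pd a b k l p :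
  Lv a k (pd (b, l) p)
  = pd (b, l) (Lv a k p) - ((a == b)%:R * Lcoef k l) *: pd (b, (l + k)%N) p.
Proof.
have lp := linear_pd.
rewrite /Lv (linopD (lp _)) addrAC; congr (_ + _); last first.
  rewrite (linopZ (lp _)) (linop_sum (lp _)); congr (_ *: _); apply: eq_bigr => i _.
  rewrite (linop_sum (lp _)); apply: eq_bigr => j _.
  by rewrite (linopZ (lp _)) 2!(pdC (b, l)).
have [K0 bp0] := exists_below p.
(* The cut must exceed l, otherwise the only term contributing to the commutator would be lost. *)
pose K := (K0 + l).+1; have bp : below K%:Z p by apply: below_le bp0; lia.
have bq : below K%:Z (pd (b, l) p).
  by have := (lowers_pd W (b, l)).2 _ _ bp; apply: below_le; lia.
rewrite !(locfin_fsum (@locfin_L1 _ _) (K := K))// (linop_sum (lp _)).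
apply/eqP; rewrite eq_sym subr_eq; apply/eqP.
have lK : (l < K)%N by rewrite /K; lia.
under eq_bigr => j _ do rewrite (linopZ (lp _)) pd_tm xpair_eqE scalerDr (pdC (b, l)).
rewrite big_split /= addrC; congr (_ + _).
rewrite (bigD1 (Ordinal lK)) //= eqxx andbT big1 ?addr0 => [|j jl].
  rewrite [b == a]eq_sym; case: eqP => [->|_]; first by rewrite scale1r mul1r.
  by rewrite mul0r !scale0r scaler0.
rewrite (_ : (l == j) = false) ?andbF ?scale0r ?scaler0//.
by apply/negbTE; apply: contra jl => /eqP lj; apply/eqP/val_inj.
Qed.

Definition va (x : nat -> F) a p : W :=
  \sum_(k \in [set k : nat | (0 < k)%N]) x k *: Lv a k p.

Lemma locfin_va (x : nat -> F) a : locfin (fun k p => x k *: Lv a k p : W).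
Proof.
apply: locfin_lowers => k; apply: lowersZ.
by apply: lowersW (lowers_Lv a k); lia.
Qed.

Lemma lowers_va x a : lowers 1 (va x a).
Proof.
apply: lowers_fsum_pos => [|k k0]; first exact: locfin_va.
by apply: lowersZ; apply: lowersW (lowers_Lv a k); lia.
Qed.

Lemma commutes_va x y a b : a != b -> commutes (va x a) (va y b).
Proof.
move=> ab; have lva : lowers 0 (va x a) by apply: lowersW (lowers_va x a).
apply: commutes_fsum_pos => // [|k k0]; first exact: locfin_va.
apply: commutes_scale; first by case: lva.
apply: commutes_sym; apply: commutes_fsum_pos => [| |l l0].
- by apply: lowersW (lowers_Lv b k); lia.
- exact: locfin_va.
- apply: commutes_scale; first by case: (lowers_Lv b k).
  by apply: commutes_Lv; rewrite eq_sym.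
Qed.

Definition ddir c p : W := \sum_(k \in [set: nat]) \sum_(a < N) c a k *: pd (a, k) p.

Lemma locfin_ddir c : locfin (fun k p => \sum_(a < N) c a k *: pd (a, k) p : W).
Proof.
move=> k p bp; rewrite big1// => a _.
by rewrite (@pd_eq0 _ _ k%:Z) ?scaler0//; lia.
Qed.

Lemma lowers_ddir c (n : int) :
  (forall a k, c a k != 0 -> n <= (vwt wa (a, k))%:Z) -> lowers n (ddir c).
Proof.
move=> h; apply: lowers_fsum => [|k]; first exact: locfin_ddir.
apply: lowers_sum => a _; have [->|/h ck] := eqVneq (c a k) 0.
  rewrite (_ : (fun p => _) = fun=> 0); first exact: lowers0.
  by apply/funext => p; rewrite scale0r.
by apply: lowersZ; apply: lowersW (lowers_pd _ _).
Qed.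

Lemma lowers0_ddir c : lowers 0 (ddir c).
Proof. exact: lowers_ddir. Qed.

Lemma commutes_ddir c c' : commutes (ddir c) (ddir c').
Proof.
have lc := lowers0_ddir c.
apply: commutes_fsum => // [|k]; first exact: locfin_ddir.
apply: commutes_sum => [|a _]; first by case: lc.
apply: commutes_scale; first by case: lc.
apply: commutes_sym; apply: commutes_fsum => [| |l].
- by apply: lowersW (lowers_pd _ _).
- exact: locfin_ddir.
- apply: commutes_sum => [|b _]; first exact: linear_pd.
  by apply: commutes_scale; [exact: linear_pd|exact: pdC].
Qed.

Variable x : 'I_N -> nat -> F.

(** The operator A. *)
Definition vtot p : W := \sum_(a < N) va (x a) a p.

Lemma lowers_vtot : lowers 1 vtot.
Proof. by apply: lowers_sum => a _; exact: lowers_va. Qed.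

(** The vector field \sum_k x_k z^(2k+1) d/dz acting on \sum_l c_l z^(2l+1) / (2l + 1)!!; the range
    l < n encodes k = n - l >= 1. *)
Definition vact c : 'I_N -> nat -> F :=
  fun a n => \sum_(l < n) x a (n - l)%N * Lcoef (n - l) l * c a l.

Lemma vtot_pd b l K p : below K%:Z p ->
  vtot (pd (b, l) p) = pd (b, l) (vtot p)
    - \sum_(k < K | (0 < k)%N) (x b k * Lcoef k l) *: pd (b, (l + k)%N) p.
Proof.
move=> bp; have lp := linear_pd.
have bq : below K%:Z (pd (b, l) p).
  by have := (lowers_pd W (b, l)).2 _ _ bp; apply: below_le; lia.
transitivity (\sum_(a < N) \sum_(k < K | (0 < k)%N) x a k *: Lv a k (pd (b, l) p)).
  by apply: eq_bigr => a _; rewrite /va (locfin_fsum_pos (@locfin_va _ _) (K := K)).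
have -> : vtot p = \sum_(a < N) \sum_(k < K | (0 < k)%N) x a k *: Lv a k p.
  by apply: eq_bigr => a _; rewrite /va (locfin_fsum_pos (@locfin_va _ _) (K := K)).
rewrite (linop_sum (lp _)) (bigD1 b)//= [in RHS](bigD1 b)//= addrAC; congr (_ + _).
  rewrite (linop_sum (lp _)) -sumrB; apply: eq_bigr => k _.
  by rewrite Lv_pd eqxx mul1r scalerBr scalerA (linopZ (lp _)).
apply: eq_bigr => a /negPf ab; rewrite (linop_sum (lp _)); apply: eq_bigr => k _.
by rewrite Lv_pd ab mul0r scale0r subr0 (linopZ (lp _)).
Qed.

Lemma vtot_ddir c p : vtot (ddir c p) = ddir c (vtot p) - ddir (vact c) p.
Proof.
have [K bp] := exists_below p.
have [lA hA] := lowers_vtot.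
have bA : below K%:Z (vtot p) by apply: below_le (hA _ _ bp); lia.
rewrite /ddir !(locfin_fsum (@locfin_ddir _) (K := K))//.
rewrite (linop_sum lA) -sumrB.
(* The condition k > 0 becomes a zero coefficient, so that the sum runs over a full square and can
   be regrouped by n = l + k. *)
transitivity (\sum_(l < K) (\sum_(b < N) c b l *: pd (b, nat_of_ord l) (vtot p)
    - \sum_(b < N) \sum_(k < K) (if (0 < k)%N then (c b l * (x b k * Lcoef k l)) else 0)
         *: pd (b, (l + k)%N) p)).
  apply: eq_bigr => l _; rewrite (linop_sum lA) -sumrB; apply: eq_bigr => b _.
  rewrite (linopZ lA) (vtot_pd _ _ bp) scalerBr scaler_sumr; congr (_ - _).
  rewrite big_mkcond /=; apply: eq_bigr => k _; case: ifP => _; last by rewrite scale0r.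
  by rewrite scalerA.
rewrite !sumrB; congr (_ - _); rewrite exchange_big/= [RHS]exchange_big/=.
apply: eq_bigr => b _.
rewrite (@tri_sum _ K (fun l k => (if (0 < k)%N then (c b l * (x b k * Lcoef k l)) else 0)
         *: pd (b, (l + k)%N) p)) => [|l k lk].
  apply: eq_bigr => n _; rewrite big_ord_recr/= subnn ltnn scale0r addr0.
  rewrite /vact scaler_suml; apply: eq_bigr => l _; rewrite (subnKC (ltnW (ltn_ord l))).
  by rewrite subn_gt0 ltn_ord; congr (_ *: _); ring.
by rewrite (@pd_eq0 _ _ K%:Z) ?scaler0//; lia.
Qed.

End Weyl.

(** * The Virasoro group element as a translation *)

Section VirasoroTranslation.

Variables (F : numFieldType) (N : nat) (wa : 'I_N -> nat) (W : weyl F wa).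
Hypothesis wa_gt0 : forall a, (0 < wa a)%N.

(** [cs n] holds the coefficients of D_n. The recursion says [A, D_n] = (n + 1) D_(n+1). In the
    weight bound, 3 is the weight of one power of hbar and 2n comes from the n factors chi_k L_k, k
    >= 1, that enter D_n. *)
Variables (x : 'I_N -> nat -> F) (cs : nat -> 'I_N -> nat -> F).
Implicit Types (p : W).
Hypothesis cs0 : forall a k, cs 0 a k = 0.
Hypothesis vact_cs : forall n, (0 < n)%N -> forall a k,
  vact x (cs n) a k = - (n.+1%:R * cs n.+1 a k).
Hypothesis cs_wt : forall n a k, cs n a k != 0 -> (3 + n.*2 <= vwt wa (a, k))%N.

Local Notation A := (@vtot _ _ _ W x).
Local Notation d n := (@ddir _ _ _ W (cs n)).

(* The coefficient of t^m in (\sum_n t^n d_n)^j. *)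
Fixpoint eps (j m : nat) (p : W) : W :=
  if j is j'.+1 then \sum_(n < m.+1) d n (eps j' (m - n) p)
  else if m == 0%N then p else 0.

Lemma linear_ddir c : linear (@ddir _ _ _ W c).
Proof. by case: (lowers0_ddir W wa_gt0 c). Qed.

Lemma ddir_cs0 p : d 0 p = 0.
Proof.
rewrite /ddir fsbig1// => k _; rewrite big1// => a _.
by rewrite cs0 scale0r.
Qed.

(** The case n = 0 is excluded because D_0 = 0 while D_1 need not vanish; this is the source of the
    correction term in [vtot_eps]. *)
Lemma vtot_cs n p : (0 < n)%N -> A (d n p) = d n (A p) + n.+1%:R *: d n.+1 p.
Proof.
move=> n0; rewrite vtot_ddir//; congr (_ + _).
have [K bp] := exists_below p.
rewrite /ddir !(locfin_fsum (@locfin_ddir _ _ _ W wa_gt0 _) (K := K))// scaler_sumr -sumrN.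
apply: eq_bigr => k _; rewrite scaler_sumr -sumrN; apply: eq_bigr => a _.
by rewrite vact_cs// scaleNr opprK scalerA.
Qed.

Lemma lowers_cs n : lowers (3 + n.*2)%:Z (d n).
Proof. by apply: lowers_ddir => // a k /cs_wt; lia. Qed.

Lemma lowers_eps j m : lowers (3 * j + m.*2)%:Z (eps j m).
Proof.
elim: j m => [|j IH] m.
  by case: m => [|m] /=; [exact: lowers_id|exact: lowers0].
apply: lowers_sum => n _; apply: lowersW (lowers_comp (lowers_cs n) (IH _)).
by have := ltn_ord n; lia.
Qed.

(** As D_0 = 0, the j-th power of the series has order at least j in t. *)
Lemma eps_gt j m p : (m < j)%N -> eps j m p = 0.
Proof.
elim: j m => // j IH m mj; rewrite /= big1// => -[[|n] /= nm] _.
  by rewrite ddir_cs0.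
by rewrite IH ?(linop0 (linear_ddir _))//; lia.
Qed.

Lemma eps_ddir j m c p : eps j m (ddir c p) = ddir c (eps j m p).
Proof.
have lc := linear_ddir c.
elim: j m => [|j IH] m /=; first by case: ifP => _; rewrite ?(linop0 lc).
rewrite (linop_sum lc); apply: eq_bigr => n _.
by rewrite IH commutes_ddir.
Qed.

(** With D(t) = \sum_n t^n D_n one has [A, D] = D' - D_1, and everything except A commutes, so
    [A, D^j] = (D^j)' - j D_1 D^(j-1); this is its t^m coefficient. *)
Lemma vtot_eps j m p :
  A (eps j m p) = eps j m (A p) + m.+1%:R *: eps j m.+1 p
    - j%:R *: d 1 (eps j.-1 m p).
Proof.
have [lA _] := lowers_vtot W wa_gt0 x; have ld := linear_ddir.
elim: j m => [|j IH] m.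
  rewrite /= scale0r subr0; case: m => [|m] /=; rewrite scaler0 addr0//.
  exact: linop0.
rewrite /= (linop_sum lA).
(* At n = 0 the left side vanishes but (n + 1) D_(n+1) is D_1; the delta term removes it. *)
have step (n : 'I_m.+1) : A (d n (eps j (m - n) p)) =
    d n (eps j (m - n) (A p)) + (m.+1 - n)%:R *: d n (eps j (m.+1 - n) p)
    - j%:R *: d 1 (d n (eps j.-1 (m - n) p))
    + n.+1%:R *: d n.+1 (eps j (m - n) p) - (n == ord0)%:R *: d 1 (eps j m p).
  have nm : (n <= m)%N by rewrite -ltnS.
  have [n0|n0] := posnP n.
    rewrite [n == ord0](_ : _ = true); last by apply/eqP/val_inj.
    rewrite n0 subn0 ddir_cs0 (linop0 lA) !ddir_cs0 (linop0 (ld _)) !scaler0 !scale1r.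
    by rewrite !addr0 subr0 add0r subrr.
  rewrite [n == ord0](_ : _ = false); last by apply/negP => /eqP e; rewrite e in n0.
  rewrite vtot_cs// IH (linopD (ld _)) (linopD (ld _)) (linopN (ld _)).
  rewrite !(linopZ (ld _)) scale0r subr0 subSn// [in RHS](@commutes_ddir _ _ _ W wa_gt0).
  by [].
rewrite (eq_bigr _ (fun n _ => step n)).
rewrite !(sumrB, big_split)/=.
have -> : \sum_(n < m.+1) (n == ord0)%:R *: d 1 (eps j m p) = d 1 (eps j m p).
  rewrite big_ord_recl big1 ?addr0 ?eqxx ?scale1r// => n _.
  by rewrite (_ : (_ == _) = false) ?scale0r//; apply/negbTE/eqP => /(congr1 val).
have -> : \sum_(n < m.+1) j%:R *: d 1 (d n (eps j.-1 (m - n) p)) = j%:R *: d 1 (eps j m p).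
  case: j {IH step} => [|j]; first by rewrite big1 => [|n _]; rewrite !scale0r.
  by rewrite /= (linop_sum (ld _)) scaler_sumr.
rewrite -!addrA; congr (_ + _).
rewrite -[j.+1]addn1 natrD scalerDl scale1r opprD.
rewrite [X in _ + X]addrCA addrCA addrA [- (j%:R *: _) + _]addrC; congr (_ + _).
(* Both sums are extended by a zero term to n < m + 2; their weights then add up to m + 1. *)
have -> : \sum_(n < m.+1) (m.+1 - n)%:R *: d n (eps j (m.+1 - n) p)
  = \sum_(n < m.+2) (m.+1 - n)%:R *: d n (eps j (m.+1 - n) p).
  by rewrite [RHS]big_ord_recr/= subnn scale0r addr0.
have -> : \sum_(n < m.+1) n.+1%:R *: d n.+1 (eps j (m - n) p)
  = \sum_(n < m.+2) n%:R *: d n (eps j (m.+1 - n) p).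
  by rewrite [RHS]big_ord_recl/= scale0r add0r; apply: eq_bigr => n _; rewrite /bump/= add1n subSS.
rewrite -big_split/= scaler_sumr; apply: eq_bigr => n _.
by rewrite -scalerDl -natrD addnC subnK// -ltnS.
Qed.

Variables (c : 'I_N -> nat -> F).
Hypothesis sum_cs : forall a k M, (k < M)%N -> c a k = \sum_(n < M) cs n a k.

Lemma ddir_sum (M : nat) p : below M%:Z p -> ddir c p = \sum_(n < M) d n p.
Proof.
move=> bp; rewrite /ddir !(locfin_fsum (@locfin_ddir _ _ _ W wa_gt0 _) (K := M))//.
under [RHS]eq_bigr => n _ do rewrite (locfin_fsum (@locfin_ddir _ _ _ W wa_gt0 _) bp).
rewrite [RHS]exchange_big/=; apply: eq_bigr => k _.
rewrite [RHS]exchange_big/=; apply: eq_bigr => a _.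
by rewrite (@sum_cs a k M)// scaler_suml.
Qed.

(** The series is evaluated at t = 1; weights kill all powers of t beyond M. *)
Lemma iter_ddir_eps (M j : nat) p : below M%:Z p ->
  iter j (ddir c) p = \sum_(m < M.+1) eps j m p.
Proof.
move=> bp; elim: j => [|j IH].
  by rewrite big_ord_recl/= big1 ?addr0.
rewrite iterS {}IH (linop_sum (linear_ddir c)).
have be m : below M.+1%:Z (eps j m p).
  by have := (lowers_eps j m).2 _ _ bp; apply: below_le; lia.
under eq_bigr => m _ do rewrite (ddir_sum (be m)).
rewrite exchange_big/= (@tri_sum _ M.+1 (fun n m => d n (eps j m p)))// => n m nm.
have := (lowers_comp (lowers_cs n) (lowers_eps j m)).2 _ _ bp.
by apply: below_eq0; lia.
Qed.

(** The least drop is that of D_1, namely 3 + 2 = 5, against a gain of 3 for each power of hbar; the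
    translation therefore has finitely many terms at each power of hbar. *)
Lemma iter_ddir_below j n p : below n p -> below (n - (5 * j)%:Z) (iter j (ddir c) p).
Proof.
move=> bp; have low5 : lowers 5 (@ddir _ _ _ W c).
  apply: lowers_ddir => // a k; rewrite (@sum_cs a k k.+1)//.
  rewrite big_ord_recl cs0 add0r => ne0.
  have [/existsP[i /cs_wt]|/existsPn h] := boolP [exists i : 'I_k, cs (lift ord0 i) a k != 0].
    by rewrite /= /bump/=; lia.
  by rewrite big1 ?eqxx// in ne0 => i _; apply/eqP; have := h i; rewrite negbK.
have := (lowers_iter j low5).2 _ _ bp; apply: below_le.
by rewrite -mulr_natr natz; lia.
Qed.

(** [DT] and the sum [c] of the D_n have to agree only on Phi, which leaves room for s_a = 0. *)
Variables (Phi : int -> W) (DT : 'I_N -> nat -> F).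
Hypothesis Phi_below : forall e : int, below (3 * e + 1) (Phi e).
Hypothesis vtot_Phi : forall e : int, A (Phi e) = d 1 (Phi (e + 1)).
Hypothesis ddir_DT_Phi : forall e : int, ddir DT (Phi e) = ddir c (Phi e).

(** This is m! times the t^m coefficient of exp(t A) Phi = exp(D(t)) Phi, each D carrying one
    1/hbar. In the induction A is moved past [eps] until it meets Phi, where it becomes D_1. *)
Lemma iter_vtot_Phi (J m : nat) (e : int) : (m < J)%N ->
  iter m A (Phi e) = \sum_(j < J) (m`!%:R / j`!%:R) *: eps j m (Phi (e + j%:Z)).
Proof.
have [lA _] := lowers_vtot W wa_gt0 x; have ld := linear_ddir.
elim: m => [|m IH] mJ.
  case: J mJ => // J _; rewrite big_ord_recl big1 ?addr0 => [|j _].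
    by rewrite /= divr1 scale1r.
  by rewrite eps_gt ?scaler0.
rewrite iterS IH ?(ltnW mJ)// (linop_sum lA).
(* [G j] arises when A hits Phi, and [G (j - 1)] is subtracted by the correction term of [vtot_eps];
   the sum telescopes and its last term is zero by [eps_gt]. *)
pose G j := (m`!%:R / j`!%:R) *: d 1 (eps j m (Phi (e + j.+1%:Z))).
pose H j := if j is j'.+1 then G j' else 0.
have step (j : 'I_J) : A ((m`!%:R / j`!%:R) *: eps j m (Phi (e + j%:Z)))
    = (m.+1`!%:R / j`!%:R) *: eps j m.+1 (Phi (e + j%:Z)) + (G j - H j).
  rewrite (linopZ lA) vtot_eps vtot_Phi eps_ddir.
  have -> : e + j%:Z + 1 = e + j.+1%:Z by lia.
  rewrite 2!scalerDr scalerN [X in X - _]addrC -addrA; congr (_ + (_ - _)).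
    by rewrite scalerA; congr (_ *: _); rewrite factS natrM; ring.
  case: j => -[|j] /= _; first by rewrite scale0r !scaler0.
  rewrite scalerA; congr (_ *: _); rewrite factS natrM.
  have j0 : j.+1%:R != 0 :> F by rewrite pnatr_eq0.
  by field; rewrite addrC natr1 j0 pnatr_eq0 -lt0n fact_gt0.
rewrite (eq_bigr _ (fun j _ => step j)).
rewrite big_split/= sumrB [X in _ + X](_ : _ = 0) ?addr0//.
case: J mJ {IH step} => // J mJ; rewrite big_ord_recr [X in _ - X]big_ord_recl/= add0r.
rewrite (_ : G J = 0) ?addr0; last by rewrite /G eps_gt// (linop0 (ld _)) scaler0.
apply/eqP; rewrite subr_eq0; apply/eqP.
by apply: eq_bigr => j _; rewrite /bump.
Qed.

Theorem pexp_vtot_translation (e : int) :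
  pexp A (Phi e)
  = \sum_(j \in [set: nat]) (j`!%:R)^-1 *: iter j (ddir DT) (Phi (e + j%:Z)).
Proof.
have iDT j e' : iter j (ddir DT) (Phi e') = iter j (ddir c) (Phi e').
  elim: j => // j IH; rewrite iterS IH.
  have := commutes_iter j (@commutes_ddir _ _ _ W wa_gt0 c DT) (Phi e').
  move=> <-; rewrite ddir_DT_Phi.
  by have := commutes_iter j (@commutes_ddir _ _ _ W wa_gt0 c c) (Phi e'); move=> ->.
(* One bound for all cuts: from weight at most 3 (e + j), the drop 3j + 2m leaves 3e - 2m, and the
   drop 5j leaves 3e - 2j. *)
pose M := (3 * `|e|%N + 2)%N.
have bPhi : below M%:Z (Phi e) by apply: below_le (Phi_below e); lia.
have ejm j m : (M <= m)%N -> eps j m (Phi (e + j%:Z)) = 0.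
  move=> Mm; have := (lowers_eps j m).2 _ _ (Phi_below (e + j%:Z)).
  by apply: below_eq0; lia.
rewrite (@fsum_trunc _ _ M); last first.
  move=> j Mj; rewrite iDT (_ : iter _ _ _ = 0) ?scaler0//.
  by have := iter_ddir_below j (Phi_below (e + j%:Z)); apply: below_eq0; lia.
transitivity (\sum_(j < M) \sum_(m < M) (j`!%:R)^-1 *: eps j m (Phi (e + j%:Z))).
  rewrite (pexpE (lowers_vtot W wa_gt0 x) bPhi) exchange_big/=.
  apply: eq_bigr => m _; rewrite (@iter_vtot_Phi M)// scaler_sumr.
  apply: eq_bigr => j _; rewrite scalerA; congr (_ *: _).
  by rewrite mulrA mulVf ?mul1r// pnatr_eq0 -lt0n fact_gt0.
apply: eq_bigr => j _; rewrite -scaler_sumr; congr (_ *: _).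
have [K bK] := exists_below (Phi (e + j%:Z)).
rewrite iDT (@iter_ddir_eps (K + M))//; last by apply: below_le bK; lia.
rewrite -(@fsum_trunc _ (fun m => eps j m (Phi (e + j%:Z))) M) => [|m /ejm//].
rewrite -(@fsum_trunc _ (fun m => eps j m (Phi (e + j%:Z))) (K + M).+1)// => m Km.
by rewrite ejm//; lia.
Qed.

End VirasoroTranslation.

(** * Power series *)

(** A copy of the sequences that carries [smul] as the product of a commutative ring. *)
Definition ps (F : Type) := nat -> F.

Section PowerSeriesRing.

Variable F : comNzRingType.
Implicit Types f g h : ps F.

HB.instance Definition _ := gen_eqMixin (ps F).
HB.instance Definition _ := gen_choiceMixin (ps F).

Definition ps_zero : ps F := fun=> 0.
Definition ps_opp f : ps F := fun n => - f n.
Definition ps_add f g : ps F := fun n => f n + g n.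

Fact ps_addA : associative ps_add.
Proof. by move=> f g h; apply/funext => n; rewrite /ps_add addrA. Qed.
Fact ps_addC : commutative ps_add.
Proof. by move=> f g; apply/funext => n; rewrite /ps_add addrC. Qed.
Fact ps_add0 : left_id ps_zero ps_add.
Proof. by move=> f; apply/funext => n; rewrite /ps_add add0r. Qed.
Fact ps_addN : left_inverse ps_zero ps_opp ps_add.
Proof. by move=> f; apply/funext => n; rewrite /ps_add addNr. Qed.

HB.instance Definition _ := GRing.isZmodule.Build (ps F) ps_addA ps_addC ps_add0 ps_addN.

(** Coefficients up to n depend only on truncations, so the ring laws are inherited from
    polynomials. *)
Lemma smul_poly f g n k : (k <= n)%N ->
  smul f g k = ((\poly_(i < n.+1) f i) * (\poly_(i < n.+1) g i))`_k.
Proof.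
move=> kn; rewrite coefM; apply: eq_bigr => i _.
by rewrite !coef_poly !ifT//; have := ltn_ord i; lia.
Qed.

Fact smulC : commutative (@smul F).
Proof. by move=> f g; apply/funext => n; rewrite !(@smul_poly _ _ n)// mulrC. Qed.

Fact smulA : associative (@smul F).
Proof.
move=> f g h; apply/funext => n.
have trunc u v : ((\poly_(i < n.+1) (smul u v) i) * (\poly_(i < n.+1) h i))`_n
   = ((\poly_(i < n.+1) u i) * (\poly_(i < n.+1) v i) * (\poly_(i < n.+1) h i))`_n.
  rewrite !coefM; apply: eq_bigr => i _; congr (_ * _).
  by rewrite coef_poly ltn_ord (@smul_poly _ _ n)// -ltnS.
have trunc' u v : ((\poly_(i < n.+1) f i) * (\poly_(i < n.+1) (smul u v) i))`_n
   = ((\poly_(i < n.+1) f i) * ((\poly_(i < n.+1) u i) * (\poly_(i < n.+1) v i)))`_n.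
  rewrite !coefM; apply: eq_bigr => i _; congr (_ * _).
  by rewrite coef_poly ltnS leq_subr (@smul_poly _ _ n)// leq_subr.
by rewrite !(@smul_poly _ _ n)// trunc trunc' mulrA.
Qed.

Fact smul1 : left_id (@sone F) (@smul F).
Proof.
move=> f; apply/funext => n; rewrite /smul big_ord_recl big1 ?addr0 => [|i _].
  by rewrite /sone eqxx mul1r subn0.
by rewrite /sone /= mul0r.
Qed.

Fact smulDl : left_distributive (@smul F) ps_add.
Proof.
move=> f g h; apply/funext => n; rewrite /smul /ps_add -big_split/=.
by apply: eq_bigr => i _; rewrite mulrDl.
Qed.

Fact sone_neq0 : (@sone F : ps F) != 0.
Proof. by apply/eqP => /(congr1 (fun f => f 0%N)) /eqP; rewrite /sone eqxx oner_eq0. Qed.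

HB.instance Definition _ := GRing.Zmodule_isComNzRing.Build (ps F)
  smulA smulC smul1 smulDl sone_neq0.

Lemma ps_addE f g n : (f + g) n = f n + g n. Proof. by []. Qed.
Lemma ps_oppE f n : (- f) n = - f n. Proof. by []. Qed.
Lemma ps_mulE f g n : (f * g) n = \sum_(i < n.+1) f i * g (n - i)%N. Proof. by []. Qed.
Lemma ps_oneE n : (1 : ps F) n = (n == 0%N)%:R. Proof. by []. Qed.

Lemma ps_sumE (J : Type) (s : seq J) (T : pred J) (G : J -> ps F) n :
  (\sum_(j <- s | T j) G j) n = \sum_(j <- s | T j) G j n.
Proof. by elim/big_rec2 : _ => // j x y _ <-. Qed.

Lemma spowE f j : spow f j = f ^+ j.
Proof. by elim: j => // j IH; rewrite exprS -IH. Qed.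

Definition ps_C (c : F) : ps F := fun n => c *+ (n == 0%N).

Lemma ps_CM c f n : (ps_C c * f) n = c * f n.
Proof.
rewrite ps_mulE big_ord_recl big1 ?addr0 => [|i _]; first by rewrite /ps_C mulr1n subn0.
by rewrite /ps_C /= mulr0n mul0r.
Qed.

(** Divisibility by z^v. *)
Definition vanish v f := forall i, (i < v)%N -> f i = 0.

Lemma vanishM u v f g : vanish u f -> vanish v g -> vanish (u + v) (f * g).
Proof.
move=> uf vg n nuv; rewrite ps_mulE big1// => i _.
have [iu|ui] := ltnP i u; first by rewrite uf ?mul0r.
by rewrite vg ?mulr0//; have := ltn_ord i; lia.
Qed.

Lemma vanishX f j : f 0%N = 0 -> vanish j (f ^+ j).
Proof.
move=> f0; elim: j => [|j IH]; first by [].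
by rewrite exprS -add1n; apply: vanishM IH => -[].
Qed.

End PowerSeriesRing.

Section PowerSeriesCalculus.

Variable F : numFieldType.
Implicit Types f g h x w : ps F.

Local Notation D := (@sderiv F : ps F -> ps F).

Lemma vanish_sderiv v f : vanish v f -> vanish v.-1 (D f).
Proof. by move=> vf i iv; rewrite /sderiv vf ?mulr0//; lia. Qed.

Lemma sderivD f g : D (f + g) = D f + D g.
Proof. by apply/funext => n; rewrite ps_addE /sderiv ps_addE mulrDr. Qed.

Lemma sderivN f : D (- f) = - D f.
Proof. by apply/funext => n; rewrite ps_oppE /sderiv ps_oppE mulrN. Qed.

Lemma sderiv1 : D 1 = 0.
Proof. by apply/funext => n; rewrite /sderiv ps_oneE mulr0. Qed.

Lemma sderivCM c f : D (ps_C c * f) = ps_C c * D f.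
Proof. by apply/funext => n; rewrite ps_CM /sderiv ps_CM mulrCA. Qed.

Lemma sderivM f g : D (f * g) = D f * g + f * D g.
Proof.
apply/funext => n; rewrite /sderiv ps_addE !ps_mulE mulr_sumr.
have -> : \sum_(i < n.+1) D f i * g (n - i)%N
    = \sum_(i < n.+2) i%:R * f i * g (n.+1 - i)%N.
  by rewrite [RHS]big_ord_recl/= mul0r mul0r add0r; apply: eq_bigr => i _; rewrite /bump/= add1n subSS.
have -> : \sum_(i < n.+1) f i * D g (n - i)%N
    = \sum_(i < n.+2) (n.+1 - i)%:R * f i * g (n.+1 - i)%N.
  rewrite [RHS]big_ord_recr/= subnn mul0r mul0r addr0; apply: eq_bigr => i _.
  by rewrite /sderiv subSn 1?mulrCA ?mulrA// -ltnS.
rewrite -big_split/=; apply: eq_bigr => i _.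
by rewrite -!mulrDl -natrD subnKC 1?mulrA// -ltnS.
Qed.

Lemma sderivX f n : D (f ^+ n) = n%:R * f ^+ n.-1 * D f.
Proof.
elim: n => [|n IH]; first by rewrite expr0 sderiv1 !mul0r.
rewrite exprS sderivM IH; case: n {IH} => [|n]; first by rewrite !expr0; ring.
by rewrite /= -[n.+2]addn1 natrD [f ^+ n.+1]exprS; ring.
Qed.

(** * Exponential of a vector field vanishing to third order *)

Section VectorField.

Variable x : ps F.
Hypothesis x_van : vanish 3 x.

Definition vfield f : ps F := - (x * D f).

(** The divided power X^m / m! of the field X = - x d/dz. *)
Definition vpow m f : ps F := ps_C (m`!%:R)^-1 * iter m vfield f.

Lemma vfieldD f g : vfield (f + g) = vfield f + vfield g.
Proof. by rewrite /vfield sderivD mulrDr opprD. Qed.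

Lemma vfieldM f g : vfield (f * g) = vfield f * g + f * vfield g.
Proof. by rewrite /vfield sderivM; ring. Qed.

Lemma vfieldCM c f : vfield (ps_C c * f) = ps_C c * vfield f.
Proof. by rewrite /vfield sderivCM; ring. Qed.

Lemma vanish_vfield v f : vanish v f -> vanish (v + 2) (vfield f).
Proof.
move=> /vanish_sderiv vf n nv; rewrite /vfield ps_oppE (vanishM x_van vf) ?oppr0//.
by lia.
Qed.

Lemma vanish_iter_vfield v f m : vanish v f -> vanish (v + m.*2) (iter m vfield f).
Proof.
move=> vf; elim: m => [|m IH]; first by rewrite addn0.
by have := vanish_vfield IH; rewrite doubleS -addnA addn2.
Qed.

(** Each application of X raises the order by 2; the cruder bound m is uniform in [f] and justifies
    stopping the sum in [vexp] at m = n. *)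
Lemma vanish_vpow m f : vanish m (vpow m f).
Proof.
move=> n nm; rewrite /vpow ps_CM.
have v0 : vanish 0 f by [].
by rewrite (@vanish_iter_vfield 0 f m v0) ?mulr0//; lia.
Qed.

Lemma ps_CC (a b : F) : ps_C a * ps_C b = ps_C (a * b) :> ps F.
Proof. by apply/funext => n; rewrite ps_CM /ps_C mulrnAr. Qed.

Lemma ps_C_nat n : (n%:R : ps F) = ps_C n%:R.
Proof.
elim: n => [|n IH]; first by apply/funext => m; rewrite /ps_C mul0rn.
rewrite mulrSr IH; apply/funext => m.
by rewrite ps_addE ps_oneE /ps_C mulrSr mulrnDl.
Qed.

Lemma vpowS m f : m.+1%:R * vpow m.+1 f = vfield (vpow m f).
Proof.
rewrite /vpow vfieldCM iterS mulrA ps_C_nat ps_CC; congr (ps_C _ * _).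
by rewrite factS natrM invfM mulrA mulfV ?mul1r// pnatr_eq0.
Qed.

Lemma ps_mulrI (n : nat) f g : n.+1%:R * f = n.+1%:R * g -> f = g.
Proof.
rewrite !ps_C_nat => e; apply/funext => m; have := congr1 (fun h => h m) e.
by rewrite !ps_CM => /mulfI; apply; rewrite pnatr_eq0.
Qed.

Lemma vfield_sum (n : nat) (G : nat -> ps F) :
  vfield (\sum_(i < n) G i) = \sum_(i < n) vfield (G i).
Proof.
elim: n => [|n IH]; last by rewrite !big_ord_recr/= vfieldD IH.
by rewrite !big_ord0 /vfield; apply/funext => m; rewrite ps_oppE ps_mulE big1 ?oppr0// => i _; rewrite /sderiv !mulr0.
Qed.

(** The Leibniz rule for divided powers has no binomial coefficients; the induction divides by m +
    1, using characteristic zero. *)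
Lemma vpowM m f g : vpow m (f * g) = \sum_(i < m.+1) vpow i f * vpow (m - i) g.
Proof.
elim: m => [|m IH].
  rewrite big_ord1 /vpow /= invr1; have -> : (ps_C 1 : ps F) = 1.
    by apply/funext => n.
  by rewrite !mul1r.
apply: (@ps_mulrI m); rewrite vpowS IH.
rewrite (@vfield_sum m.+1 (fun i => vpow i f * vpow (m - i) g)).
under eq_bigr => i _ do rewrite vfieldM -!vpowS.
rewrite big_split/=.
have -> : \sum_(i < m.+1) i.+1%:R * vpow i.+1 f * vpow (m - i) g
   = \sum_(i < m.+2) i%:R * vpow i f * vpow (m.+1 - i) g.
  by rewrite [RHS]big_ord_recl/= mul0r mul0r add0r; apply: eq_bigr => i _; rewrite /bump/= add1n subSS.
have -> : \sum_(i < m.+1) vpow i f * ((m - i).+1%:R * vpow (m - i).+1 g)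
   = \sum_(i < m.+2) (m.+1 - i)%:R * vpow i f * vpow (m.+1 - i) g.
  rewrite [RHS]big_ord_recr/= subnn mul0r mul0r addr0; apply: eq_bigr => i _.
  by rewrite subSn -1?ltnS//; ring.
rewrite -big_split mulr_sumr/=; apply: eq_bigr => i _.
by rewrite -!mulrDl -natrD subnKC 1?mulrA// -ltnS.
Qed.

Definition vexp f : ps F := fun n => \sum_(m < n.+1) vpow m f n.

Lemma vexpEw f n M : (n < M)%N -> vexp f n = \sum_(m < M) vpow m f n.
Proof.
move=> nM; rewrite /vexp -(@fsum_trunc _ (fun m => vpow m f n) n.+1) => [|k nk].
  by apply: fsum_trunc => k Mk; rewrite vanish_vpow//; lia.
exact: vanish_vpow.
Qed.

(** The exponential of a derivation is multiplicative: [vpowM] is the Cauchy product of the two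
    exponentials. *)
Lemma vexpM f g : vexp (f * g) = vexp f * vexp g.
Proof.
apply/funext => n; rewrite ps_mulE.
transitivity (\sum_(p < n.+1) \sum_(i < n.+1) \sum_(j < n.+1) vpow i f p * vpow j g (n - p)%N).
  rewrite exchange_big/=.
  transitivity (\sum_(i < n.+1) \sum_(j < n.+1) (vpow i f * vpow j g) n).
    rewrite (@tri_sum _ _ (fun i j => (vpow i f * vpow j g) n)) => [|i j ij].
      by apply: eq_bigr => m _; rewrite vpowM ps_sumE.
    exact: (vanishM (@vanish_vpow i f) (@vanish_vpow j g)).
  by apply: eq_bigr => i _; rewrite exchange_big.
apply: eq_bigr => p _; rewrite (@vexpEw f p n.+1)// (@vexpEw g (n - p) n.+1) ?ltnS ?leq_subr//.
by rewrite mulr_suml; apply: eq_bigr => i _; rewrite mulr_sumr.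
Qed.

Lemma vexp1 : vexp 1 = 1.
Proof.
apply/funext => n; rewrite /vexp big_ord_recl big1 => [|m _].
  rewrite addr0 /vpow /= invr1 ps_CM mul1r//.
rewrite /vpow ps_CM [iter _ _ _](_ : _ = 0) ?mulr0//.
have v1 : vfield 1 = 0 by rewrite /vfield sderiv1; ring.
have v0 : vfield 0 = 0.
  by have := vfieldD 0 0; rewrite addr0 => /eqP; rewrite -subr_eq subrr eq_sym => /eqP.
by rewrite /=; elim: (nat_of_ord m) => [//|k /=] ->.
Qed.

Lemma vexpX f d : vexp (f ^+ d) = vexp f ^+ d.
Proof. by elim: d => [|d IH]; rewrite ?expr0 ?vexp1// !exprS vexpM IH. Qed.

End VectorField.

(** * Binomial series *)

Lemma gbinomS (c : F) j : j.+1%:R * gbinom c j.+1 = (c - j%:R) * gbinom c j.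
Proof.
rewrite /gbinom big_ord_recr/= factS natrM.
have j0 : j.+1%:R != 0 :> F by rewrite pnatr_eq0.
have f0 : j`!%:R != 0 :> F by rewrite pnatr_eq0 -lt0n fact_gt0.
by field; rewrite f0 addrC natr1 j0.
Qed.

Definition binpart x c M : ps F := \sum_(j < M) ps_C (gbinom c j) * x ^+ j.

Lemma spow1p_trunc x c M n : x 0%N = 0 -> (n < M)%N -> spow1p x c n = binpart x c M n.
Proof.
move=> x0 nM; rewrite /binpart ps_sumE /spow1p.
under [RHS]eq_bigr => j _ do rewrite ps_CM.
under [LHS]eq_bigr => j _ do rewrite spowE.
rewrite -(@fsum_trunc _ (fun j => gbinom c j * (x ^+ j) n) n.+1) => [|k nk].
  by apply: fsum_trunc => k Mk; rewrite (@vanishX _ _ k x0) ?mulr0//; lia.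
by rewrite (@vanishX _ _ k x0) ?mulr0//; lia.
Qed.

(** A partial sum satisfies the equation (1 + x) y' = c x' y of (1 + x)^c up to one boundary term,
    the remaining terms cancelling by the recursion of the binomial coefficients. *)
Lemma binpart_ode x c M :
  (1 + x) * D (binpart x c M) - ps_C c * D x * binpart x c M
  = - (M%:R * ps_C (gbinom c M) * x ^+ M.-1 * D x).
Proof.
rewrite /binpart; elim: M => [|M IH].
  rewrite !big_ord0 mulr0 subr0 !mul0r oppr0.
  by apply/funext => n; rewrite ps_mulE big1// => i _; rewrite /sderiv !mulr0.
rewrite !big_ord_recr/= sderivD mulrDr mulrDr opprD addrACA IH sderivCM sderivX.
have -> : M.+1%:R * ps_C (gbinom c M.+1) = (ps_C c - M%:R) * ps_C (gbinom c M).
  rewrite !ps_C_nat ps_CC gbinomS -ps_CC; congr (_ * _).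
  by apply/funext => n; rewrite ps_addE ps_oppE /ps_C mulrnBl.
case: M {IH} => [|M]; first by rewrite !expr0; ring.
by rewrite /= exprS; ring.
Qed.

Lemma spow1p_ode x c : x 0%N = 0 ->
  (1 + x) * D (spow1p x c) = ps_C c * D x * spow1p x c.
Proof.
move=> x0; apply/funext => n; set G : ps F := spow1p x c.
(* The derivative at degree n sees coefficient n + 1, and with n + 2 terms the boundary term
   contains x^(n+1), which vanishes in degree n. *)
pose B := binpart x c n.+2.
have GB k : (k <= n.+1)%N -> G k = B k by move=> kn; rewrite /G (@spow1p_trunc _ _ n.+2).
have : ((1 + x) * D B - ps_C c * D x * B) n = 0.
  rewrite binpart_ode ps_oppE (_ : _ * _ * x ^+ n.+1 * D x = x ^+ n.+1 * (n.+2%:R * ps_C (gbinom c n.+2) * D x)).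
    have v0 : vanish 0 (n.+2%:R * ps_C (gbinom c n.+2) * D x) by [].
    by rewrite (vanishM (@vanishX _ _ n.+1 x0) v0) ?oppr0// addn0.
  by rewrite /=; ring.
rewrite ps_addE ps_oppE => /eqP; rewrite subr_eq0 => /eqP e.
transitivity (((1 + x) * D B) n).
  by rewrite !ps_mulE; apply: eq_bigr => i _; rewrite /sderiv GB//; lia.
rewrite e !ps_mulE; apply: eq_bigr => i _; rewrite GB//; lia.
Qed.

(** As x has no constant term, degree n expresses (n + 1) w_(n+1) through w_0, ..., w_n. *)
Lemma ode_uniq x w : x 0%N = 0 -> w 0%N = 0 -> (1 + x) * D w = D x * w -> w = 0.
Proof.
move=> x0 w0 e; apply/funext => n; elim/ltn_ind: n => -[//|n] IH.
have := congr1 (fun h => h n) e; rewrite mulrDl mul1r ps_addE !ps_mulE.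
rewrite [X in _ + X]big1 => [|i _]; last first.
  case: i => -[|i] /= i_n; first by rewrite x0 mul0r.
  by rewrite /sderiv IH ?mulr0//; lia.
rewrite addr0 big1 => [|i _]; last by rewrite IH ?mulr0//; lia.
by rewrite /sderiv => /eqP; rewrite mulf_eq0 pnatr_eq0/= => /eqP.
Qed.

(** Both sides solve (1 + x) y' = x' y with constant term 1. *)
Lemma spow1p_root x (d : nat) : x 0%N = 0 -> (0 < d)%N ->
  (spow1p x d%:R^-1 : ps F) ^+ d = 1 + x.
Proof.
move=> x0 d0; set G : ps F := spow1p _ _.
have G0 : G 0%N = 1.
  rewrite /G /spow1p big_ord1 spowE expr0 ps_oneE /gbinom big_ord0 /=.
  by rewrite divr1 mulr1.
have Gd0 : (G ^+ d) 0%N = 1.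
  elim: (d) => [|k IH]; first by rewrite expr0.
  by rewrite exprS ps_mulE big_ord1 subnn IH G0 mulr1.
apply/eqP; rewrite -subr_eq0; apply/eqP; apply: (ode_uniq x0).
  by rewrite ps_addE ps_oppE ps_addE Gd0 x0 addr0 subrr.
rewrite sderivD sderivN sderivD sderiv1 add0r sderivX.
have -> : (1 + x) * (d%:R * G ^+ d.-1 * D G - D x)
   = d%:R * G ^+ d.-1 * ((1 + x) * D G) - (1 + x) * D x by ring.
rewrite spow1p_ode// -/G.
have dC : d%:R * ps_C d%:R^-1 = 1 :> ps F.
  rewrite ps_C_nat ps_CC mulfV ?pnatr_eq0 -?lt0n//.
have -> : d%:R * G ^+ d.-1 * (ps_C d%:R^-1 * D x * G)
   = (d%:R * ps_C d%:R^-1) * D x * (G * G ^+ d.-1) by ring.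
by rewrite dC -exprS prednK//; ring.
Qed.

End PowerSeriesCalculus.

(** * The change of coordinate f(z) *)

Section Reparametrization.

Variables (F : numFieldType) (s : F) (al : nat) (DT chi : nat -> F).

Local Notation d := al.*2.+1.
Local Notation x := (chiser chi : ps F).

Definition zps : ps F := fun n => (n == 1%N)%:R.

Lemma zpsM (g : ps F) n : (zps * g) n = if n is n'.+1 then g n' else 0.
Proof.
rewrite ps_mulE; case: n => [|n]; first by rewrite big_ord1 /zps mul0r.
rewrite big_ord_recl big_ord_recl big1 => [|i _]; last by rewrite /zps mul0r.
by rewrite /zps /= mul0r mul1r add0r addr0 /bump /= subSS subn0.
Qed.

Lemma zpsXM k (g : ps F) n : (zps ^+ k * g) n = if (k <= n)%N then g (n - k)%N else 0.
Proof.
elim: k n => [|k IH] n; first by rewrite expr0 mul1r subn0.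
by rewrite exprS -mulrA zpsM; case: n => [|n]//; rewrite IH subSS.
Qed.

Lemma vanish_chiser : vanish 3 x.
Proof. by move=> [|[|[|i]]]. Qed.

Lemma vanish_vpow_zpsX n : vanish (d + n.*2) (vpow x n (zps ^+ d)).
Proof.
have vz : vanish d (zps ^+ d) by apply: vanishX.
by move=> i iv; rewrite /vpow ps_CM (vanish_iter_vfield vanish_chiser vz iv) mulr0.
Qed.

Lemma exp_field_vexp : exp_field chi (zser F) = vexp x zps.
Proof.
apply/funext => n; rewrite /exp_field /exp_op.
rewrite (@fsum_trunc _ _ n.+1) => [|m nm].
  by apply: eq_bigr => m _; rewrite /vpow ps_CM.
have v0 : vanish 0 zps by [].
have := @vanish_iter_vfield _ x vanish_chiser 0 zps m v0 n.
move=> h; rewrite (_ : iter m _ _ n = 0) ?scaler0//.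
by apply: h; lia.
Qed.

Hypothesis fser_exp : fser s al DT = exp_field chi (zser F).

(** Multiplicativity of exp(X) gives the d-th power of f, which undoes the root in [fser]. *)
Lemma vexp_zpsX n :
  vexp x (zps ^+ d) n = (zps ^+ d) n - d%:R * vser s al DT n.
Proof.
(* v starts in degree d + 2, so division by z^d loses no coefficient and leaves no constant term. *)
pose y : ps F := fun i => - (d%:R * vser s al DT (i + d)%N).
have y0 : y 0%N = 0.
  rewrite /y /vser add0n (_ : (_ && _) = false) ?mulr0 ?oppr0//.
  by apply/negbTE; lia.
have fE : vexp x zps = zps * (spow1p y d%:R^-1 : ps F).
  rewrite -exp_field_vexp -fser_exp; apply/funext => -[|m]; rewrite zpsM//.
rewrite vexpX; last exact: vanish_chiser.
rewrite fE exprMn spow1p_root// mulrDr mulr1 ps_addE zpsXM; congr (_ + _).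
case: ltnP => dn; first by rewrite /y /= subnK.
rewrite /vser (_ : (_ && _) = false) ?mulr0 ?oppr0//.
by apply/negbTE; lia.
Qed.

(* n! times this family is the (n-1)-fold commutator of the Virasoro field with
   1/s \sum_k chi_k (2(k + al) + 1)!! d/dT_{k + al}, under the dictionary
   (2k + 1)!! d/dT_k <-> z^(2k + 1). *)
Definition tcoef (n k : nat) : F :=
  if n == 0%N then 0
  else - ((d%:R * s)^-1 * (dfact k.+1)%:R * vpow x n (zps ^+ d) k.*2.+1).

Lemma tcoef_wt n k : tcoef n k != 0 -> (d + n.*2 <= k.*2.+1)%N.
Proof.
rewrite leqNgt; apply: contra => h; rewrite /tcoef; case: ifP => // _.
by rewrite vanish_vpow_zpsX// mulr0 oppr0.
Qed.

(** The sum over n >= 1 of X^n z^d / n! is - d v, read off in degree 2k + 1. For s = 0 the inverse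
    in [tcoef] is 0, hence the factor s / s. *)
Lemma sum_tcoef k M : (k < M)%N ->
  \sum_(n < M) tcoef n k = if (al < k)%N then s / s * DT k else 0.
Proof.
case: M => // M kM.
have dn0 : d%:R != 0 :> F by rewrite pnatr_eq0.
have E : \sum_(n < M.+1) vpow x n (zps ^+ d) k.*2.+1 = vexp x (zps ^+ d) k.*2.+1.
  rewrite /vexp -(@fsum_trunc _ (fun n => vpow x n (zps ^+ d) k.*2.+1) k.*2.+2) => [|m km].
    by apply/esym/fsum_trunc => m Mm; rewrite vanish_vpow_zpsX//; lia.
  by rewrite vanish_vpow_zpsX//; lia.
move: E; rewrite vexp_zpsX !big_ord_recl/=.
have -> : vpow x 0 (zps ^+ d) = zps ^+ d.
  by apply/funext => i; rewrite /vpow ps_CM /= invr1 mul1r.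
(* The term z^d of order zero cancels; [tcoef] is 0 at n = 0 accordingly. *)
move=> /addrI E.
rewrite [tcoef 0 k]/tcoef eqxx add0r.
transitivity (- ((d%:R * s)^-1 * (dfact k.+1)%:R * (- (d%:R * vser s al DT k.*2.+1)))).
  by rewrite -E mulr_sumr -sumrN.
rewrite /vser /= odd_double /= uphalf_double; case: ifP => _; last by rewrite mulr0 oppr0 mulr0 oppr0.
rewrite invfM; have df0 : (dfact k.+1)%:R != 0 :> F.
  by rewrite pnatr_eq0 -lt0n prodn_gt0.
have [->|s0] := eqVneq s 0; first by rewrite !(mul0r, mulr0, oppr0).
move: dn0 df0; move: (d%:R : F) ((dfact k.+1)%:R : F) => u v u0 v0.
by field; rewrite u0 s0 v0.
Qed.

Lemma sum_pairs (V : nmodType) K (G : nat -> V) :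
  \sum_(i < K.*2) G i = \sum_(m < K) (G m.*2 + G m.*2.+1).
Proof.
elim: K => [|K IH]; first by rewrite !big_ord0.
by rewrite doubleS !big_ord_recr/= IH addrA.
Qed.

(** chi(z) is odd, so in odd degrees only the odd coefficients of [g] enter, and these are the ones
    matched with the d/dT_l. *)
Lemma vfield_chiser_odd (g : ps F) k :
  vfield x g k.*2.+1 = - \sum_(l < k) chi (k - l)%N * (l.*2.+1%:R * g l.*2.+1).
Proof.
rewrite /vfield ps_oppE ps_mulE; congr (- _).
rewrite -[k.*2.+2]/(k.+1.*2) (@sum_pairs _ k.+1 (fun i => chiser chi i * sderiv g (k.*2.+1 - i)%N)).
rewrite big_ord_recl/= /chiser /= !mul0r addr0 add0r.
rewrite [RHS](reindex_inj rev_ord_inj)/=; apply: eq_bigr => i _.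
rewrite /bump/= add1n doubleS /= odd_double/= mul0r add0r uphalf_double /sderiv.
have ik := ltn_ord i.
have -> : (k.*2.+1 - i.*2.+3)%N = (k - i.+1).*2 by lia.
by have -> : (k - (k - i.+1))%N = i.+1 by lia.
Qed.

(** Under the dictionary, [vact] is - X, and this is (n + 1) X^(n+1) / (n + 1)! = X (X^n / n!). *)
Lemma tcoefS n k : (0 < n)%N ->
  \sum_(l < k) chi (k - l)%N * Lcoef F (k - l) l * tcoef n l = - (n.+1%:R * tcoef n.+1 k).
Proof.
move=> n0; rewrite /tcoef eqn0Ngt n0 /= mulrN opprK.
have -> : n.+1%:R * ((d%:R * s)^-1 * (dfact k.+1)%:R * vpow x n.+1 (zps ^+ d) k.*2.+1)
   = (d%:R * s)^-1 * (dfact k.+1)%:R * (n.+1%:R * vpow x n.+1 (zps ^+ d)) k.*2.+1.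
  by rewrite ps_C_nat ps_CM mulrCA.
rewrite vpowS vfield_chiser_odd mulrN mulr_sumr -sumrN; apply: eq_bigr => l _.
rewrite mulrN; congr (- _); rewrite /Lcoef subnKC 1?ltnW// addn1.
have -> : (dfact l.+1)%:R = (dfact l)%:R * l.*2.+1%:R :> F.
  by rewrite -natrM /dfact big_ord_recr.
have df0 : (dfact l)%:R != 0 :> F by rewrite pnatr_eq0 -lt0n prodn_gt0.
set u := (d%:R * s)^-1; by field.
Qed.

(** X z^d = - d \sum_k chi_k z^(2k+d), and d cancels: these are the coefficients that the Virasoro
    constraints give for A Phi. *)
Lemma tcoef1 k : tcoef 1 k =
  if (al < k)%N then s^-1 * (dfact k.+1)%:R * chi (k - al)%N else 0.
Proof.
have dn0 : d%:R != 0 :> F by rewrite pnatr_eq0.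
have -> : tcoef 1 k = - ((d%:R * s)^-1 * (dfact k.+1)%:R * vfield x (zps ^+ d) k.*2.+1).
  by rewrite /tcoef /= /vpow ps_CM /= invr1 mul1r.
rewrite vfield_chiser_odd.
have z l : (zps ^+ d) l.*2.+1 = (l == al)%:R.
  rewrite -[zps ^+ d]mulr1 zpsXM ps_oneE; case: ltnP => h; first congr (_%:R)%R.
    by apply/eqP/eqP; lia.
  by rewrite (_ : (l == al) = false)//; apply/negbTE/eqP; lia.
under eq_bigr => l _ do rewrite z.
case: ltnP => alk.
  rewrite (bigD1 (Ordinal alk))//= big1 ?addr0 => [|l la].
    rewrite eqxx invfM /= mulr1; move: dn0; move: (d%:R : F) (s^-1) => u v u0; by field.
  rewrite (_ : (_ == _) = false) ?mulr0//; apply: contraNF la => /eqP e.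
  exact/eqP/val_inj.
rewrite big1 ?oppr0 ?mulr0 ?oppr0// => l _.
rewrite (_ : (_ == _) = false) ?mulr0//; apply/negbTE/eqP => e.
by have := ltn_ord l; rewrite e ltnNge alk.
Qed.

End Reparametrization.

(** * Derivations and weights of polynomials *)

Section Polynomials.

Variables (F : numFieldType) (I : choiceType).

Local Notation P := {malg F[{cmonom I}]}.
Local Notation "m1 ** m2" := (mmul m1 m2) (at level 40, left associativity).
Implicit Types (p q : P) (m : {cmonom I}) (i j : I).

Lemma malgUZ (c : F) m : << c *g m >> = c *: (<< m >> : P).
Proof.
apply/malgP => k; rewrite mcoeffU mcoeffZ mcoeffU; case: eqP => _.
  by rewrite !mulr1n mulr1.
by rewrite !mulr0n mulr0.
Qed.

Lemma mcoeff_lin (c : F) p q m : (c *: p + q)@_m = c * p@_m + q@_m.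
Proof. by rewrite mcoeffD mcoeffZ. Qed.

Lemma malg_linop_ext (V : lmodType F) (A B : P -> V) : linear A -> linear B ->
  (forall m, A << m >> = B << m >>) -> A =1 B.
Proof.
move=> lA lB AB p; rewrite (monalgE p) (linop_sum lA) (linop_sum lB); apply: eq_bigr => m _.
by rewrite malgUZ (linopZ lA) (linopZ lB) AB.
Qed.

Lemma linear_mulr q : linear (fun p : P => p * q).
Proof. by move=> c x y; rewrite mulrDl -(scalerAl c x q). Qed.

Lemma linear_mull q : linear (fun p : P => q * p).
Proof. by move=> c x y; rewrite mulrDr -(scalerAr c q x). Qed.

(** Replaces the sum over the support by a formula for coefficients; linearity, commutation and the
    effect on weights follow from it. *)
Lemma mcoeff_pderiv i p m : (pderiv i p)@_m = p@_(ucm i ** m) *+ (m i).+1.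
Proof.
rewrite /pderiv raddf_sum/=.
under eq_bigr => k _ do rewrite mcoeffU.
have [im|imN] := boolP ((ucm i ** m) \in msupp p).
  rewrite (big_fsetD1 _ im)/= big1_seq ?addr0.
    have -> : (divcm (ucm i ** m) (ucm i) == m).
      by apply/cmP => j; rewrite divcmE cmM addKn.
    by rewrite cmM cmUU.
  move=> k /andP[_]; rewrite in_fsetD1 => /andP[kim _].
  case: eqP => // km; case k0 : (k i) => [|n]; first by rewrite mulr0n.
  case/negP: kim; apply/cmP => j; rewrite cmM -km divcmE cmU.
  by case: eqP => [<-|_]; rewrite ?subn0 ?add0n// k0 subn1.
rewrite (mcoeff_outdom imN) mul0rn big1_seq// => k /andP[_ ks].
case: eqP => // km; case k0 : (k i) => [|n]; first by rewrite mulr0n.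
case/negP: imN; suff -> : (ucm i ** m) = k by [].
apply/eqP/cmP => j; rewrite cmM -km divcmE cmU.
by case: eqP => [<-|_]; rewrite ?subn0 ?add0n// k0 subn1.
Qed.

Lemma pderivU i m : pderiv i (<< m >> : P) = << divcm m (ucm i) >> *+ m i.
Proof. by rewrite /pderiv msuppU1 big_seq_fset1 mcoeffUU monalgUMn. Qed.

Lemma malgUM m m' : (<< m >> : P) * << m' >> = << (m ** m') >>.
Proof. by rewrite malgM_def fgmulUU mulr1. Qed.

Lemma linear_pderiv i : linear (@pderiv F I i).
Proof.
have alg (c u v : F) n : (c * u + v) *+ n = c * (u *+ n) + v *+ n.
  by rewrite mulrnDl mulrnAr.
move=> c p q; apply/malgP => m.
apply: etrans (mcoeff_pderiv _ _ _) _.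
apply: etrans (congr1 (fun u => u *+ _) (mcoeff_lin c p q _)) _.
apply: etrans (alg _ _ _ _) _; apply/esym.
apply: etrans (mcoeff_lin c (pderiv i p) (pderiv i q) m) _.
exact: (congr2 (fun u v => c * u + v) (mcoeff_pderiv i p m) (mcoeff_pderiv i q m)).
Qed.

Lemma pderivM i p q : pderiv i (p * q) = pderiv i p * q + p * pderiv i q.
Proof.
have lD := linear_pderiv i.
have red (u : P) : (forall m, pderiv i (<< m >> * u) = pderiv i << m >> * u + << m >> * pderiv i u) ->
    forall p', pderiv i (p' * u) = pderiv i p' * u + p' * pderiv i u.
  apply: (@malg_linop_ext P (fun p' => pderiv i (p' * u)) (fun p' => pderiv i p' * u + p' * pderiv i u)).
    exact: linop_comp lD (linear_mulr u).
  exact: linop_add (linop_comp (linear_mulr u) lD) (linear_mulr _).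
apply: red => m; move: q.
apply: (@malg_linop_ext P (fun q => pderiv i (<< m >> * q)) (fun q => pderiv i << m >> * q + << m >> * pderiv i q)).
- exact: linop_comp lD (linear_mull _).
- exact: linop_add (linear_mull _) (linop_comp (linear_mull _) lD).
move=> m'.
apply: etrans (congr1 (pderiv i) (malgUM m m')) _.
apply: etrans (pderivU i (m ** m')) _.
apply/esym; apply: etrans (congr2 +%R (etrans (congr1 ( *%R^~ _) (pderivU i m))
   (etrans (mulrnAl _ _ _) (congr1 (fun u => u *+ _) (malgUM _ _))))
  (etrans (congr1 ( *%R _) (pderivU i m'))
   (etrans (mulrnAr _ _ _) (congr1 (fun u => u *+ _) (malgUM _ _))))) _.
apply/esym; rewrite cmM; apply: etrans (mulrnDr _ _ _) _.
(* The truncated subtraction in [divcm] is wrong only where the exponent is 0, and there the term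
   carries the factor 0. *)
have cong (k1 k2 : {cmonom I}) n : (n != 0%N -> k1 = k2) -> (<< k1 >> : P) *+ n = << k2 >> *+ n.
  case: n => [_|n h]; last by rewrite h.
  exact: etrans (mulr0n _) (esym (mulr0n _)).
apply: (congr2 +%R); apply: cong => mi; apply/eqP/cmP => j;
  rewrite !(divcmE, cmM, cmU); case: (i =P j) => [ij|_]; rewrite ?subn0//.
  by rewrite -ij; lia.
by rewrite -ij; lia.
Qed.

Lemma pderiv_tvar i j : pderiv i (tvar F j) = (i == j)%:R.
Proof.
apply: etrans (pderivU i (ucm j)) _; rewrite cmU.
have [->|ij] := eqVneq i j; last first.
  exact: etrans (mulr0n _) (esym (mulr0n _)).
have -> : divcm (ucm j) (ucm j) = mone by apply/eqP/cmP => k; rewrite divcmE subnn cm1.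
exact: erefl.
Qed.

Lemma pderiv1 i : pderiv i (1 : P) = 0.
Proof. by apply: etrans (pderivU i mone) _; rewrite cm1; exact: mulr0n. Qed.

Lemma pderivC i j : commutes (@pderiv F I i) (@pderiv F I j).
Proof.
move=> p; apply/malgP => m.
apply: etrans (mcoeff_pderiv i (pderiv j p) m) _.
apply: etrans (congr1 (fun u => u *+ _) (mcoeff_pderiv j p _)) _; apply/esym.
apply: etrans (mcoeff_pderiv j (pderiv i p) m) _.
apply: etrans (congr1 (fun u => u *+ _) (mcoeff_pderiv i p _)) _.
rewrite !cmM !cmU mulmA [(ucm i ** ucm j)]mulmC -mulmA eq_sym; move: (p@_ _) => a.
by rewrite -!mulrnA; congr (_ *+ _); case: eqP => [->|_]; lia.
Qed.

Lemma pderiv_tvarM i j p :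
  pderiv i (tvar F j * p) = (i == j)%:R *: p + tvar F j * pderiv i p.
Proof.
apply: etrans (pderivM _ _ _) _; apply: (congr2 +%R) => //.
rewrite pderiv_tvar; case: (i == j); first exact: etrans (mul1r _) (esym (scale1r _)).
exact: etrans (mul0r _) (esym (scale0r _)).
Qed.

(** T_i d/dT_i is diagonal in the monomial basis; this makes L_0 a weighted degree operator. *)
Lemma mcoeff_tvar_pderiv i p m : (tvar F i * pderiv i p)@_m = (m i)%:R * p@_m.
Proof.
have lA : linear (fun p' : P => tvar F i * pderiv i p').
  exact: linop_comp (linear_mull _) (linear_pderiv i).
have : tvar F i * pderiv i p = \sum_(k <- msupp p) << (k i)%:R * p@_k *g k >>.
  transitivity (\sum_(k <- msupp p) tvar F i * pderiv i << p@_k *g k >>).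
    apply: etrans (congr1 (fun u => tvar F i * pderiv i u) (monalgE p)) _.
    exact: (linop_sum lA).
  apply: eq_bigr => k _; rewrite malgUZ (linopZ lA).
  have -> : tvar F i * pderiv i (<< k >> : P) = (k i)%:R *: << k >>.
    apply: etrans (congr1 ( *%R _) (pderivU i k)) _.
    apply: etrans (mulrnAr _ _ _) _; apply/esym; apply: etrans (scaler_nat _ _) _.
    case ki : (k i) => [|n]; first exact: etrans (mulr0n _) (esym (mulr0n _)).
    apply: (congr1 (fun u => u *+ n.+1)); apply: etrans _ (esym (malgUM _ _)).
    have -> // : ucm i ** divcm k (ucm i) = k.
    apply/eqP/cmP => j; rewrite !(divcmE, cmM, cmU).
    by case: (i =P j) => [ij|_]; rewrite ?subn0// -ij ki subnKC.
  apply: etrans (scalerA _ _ _) _; rewrite [RHS]malgUZ.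
  by apply: (congr1 ( *:%R^~ _)); exact: mulrC.
move=> ->.
have coef (f : {cmonom I} -> F) :
    (\sum_(k <- msupp p) << f k *g k >>)@_m = f m *+ (m \in msupp p).
  rewrite raddf_sum/=; under eq_bigr => k _ do rewrite mcoeffU.
  have [ms|ms] := boolP (m \in msupp p).
    rewrite (big_fsetD1 _ ms)/= eqxx big1_seq ?addr0// => k /andP[_].
    by rewrite in_fsetD1 => /andP[/negPf -> _].
  rewrite big1_seq// => k /andP[_ ks]; case: eqP => // km.
  by rewrite -km ks in ms.
apply: etrans (coef _) _; have [//|ms] := boolP (m \in msupp p).
by rewrite (mcoeff_outdom ms) mulr0.
Qed.

Section Weight.

Variable w : I -> nat.

Definition wt m : nat := \sum_(i <- finsupp m) w i * m i.

Lemma wtEw m (d : {fset I}) : (finsupp m `<=` d)%fset ->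
  wt m = (\sum_(i <- d) w i * m i)%N.
Proof.
move=> le; rewrite /wt (big_fset_incl _ le)//= => i _.
by rewrite -cmE_eq0 => /eqP ->; rewrite muln0.
Qed.

Lemma wtM m m' : wt (m ** m') = (wt m + wt m')%N.
Proof.
rewrite (@wtEw m (finsupp m `|` finsupp m')%fset) ?fsubsetUl//.
rewrite (@wtEw m' (finsupp m `|` finsupp m')%fset) ?fsubsetUr//.
by rewrite /wt mdomD -big_split; apply: eq_bigr => i _; rewrite cmM mulnDr.
Qed.

Lemma wtU i : wt (ucm i) = w i.
Proof. by rewrite /wt mdomU big_seq_fset1 cmUU muln1. Qed.

(** A predicate on weights covers both the filtration (weight < n) and homogeneity (weight = n). *)
Definition wsupp (Q : int -> bool) p := forall m, ~~ Q (wt m)%:Z -> p@_m = 0.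

Lemma wsupp_lin Q (c : F) p q : wsupp Q p -> wsupp Q q -> wsupp Q (c *: p + q).
Proof. by move=> Qp Qq m Qm; rewrite mcoeff_lin Qp// Qq// mulr0 addr0. Qed.

Lemma wsupp0 Q : wsupp Q 0.
Proof. by move=> m _; rewrite mcoeff0. Qed.

Lemma wsuppD Q p q : wsupp Q p -> wsupp Q q -> wsupp Q (p + q).
Proof. by move=> Qp Qq; rewrite -[p]scale1r; apply: wsupp_lin. Qed.

Lemma wsuppZ Q c p : wsupp Q p -> wsupp Q (c *: p).
Proof. by move=> Qp; rewrite -[_ *: _]addr0; apply: wsupp_lin => //; exact: wsupp0. Qed.

Lemma wsupp_sum Q (J : Type) (s : seq J) (T : pred J) (G : J -> P) :
  (forall l, T l -> wsupp Q (G l)) -> wsupp Q (\sum_(l <- s | T l) G l).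
Proof. by move=> h; elim/big_rec : _ => [|l x Tl]; [exact: wsupp0|apply: wsuppD; exact: h]. Qed.

Lemma wsuppW (Q Q' : int -> bool) p : (forall z, Q z -> Q' z) -> wsupp Q p -> wsupp Q' p.
Proof. by move=> QQ' Qp m; move/(contra (QQ' _)); exact: Qp. Qed.

Lemma wsuppM (Q Q' Q2 : int -> bool) p q :
  (forall a b, Q a -> Q' b -> Q2 (a + b)) ->
  wsupp Q p -> wsupp Q' q -> wsupp Q2 (p * q).
Proof.
move=> QQ' Qp Qq m Qm; rewrite mcoeffMl big1// => k _; rewrite big1// => l _.
case: eqP => // kl; rewrite mulr1n.
have [/Qp->|Qk] := boolP (~~ Q (wt k)%:Z); first by rewrite mul0r.
have [/Qq->|Ql] := boolP (~~ Q' (wt l)%:Z); first by rewrite mulr0.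
case/negP: Qm; rewrite -kl wtM PoszD; apply: QQ'; exact/negPn.
Qed.

Lemma wsupp_tvarM (Q Q' : int -> bool) i p : (forall z, Q z -> Q' (z + (w i)%:Z)) ->
  wsupp Q p -> wsupp Q' (tvar F i * p).
Proof.
move=> QQ' Qp; apply: (@wsuppM (fun z => z == (w i)%:Z) Q) Qp => [a b /eqP-> /QQ'|m].
  by rewrite addrC.
by rewrite mcoeffU; case: (ucm i =P m) => // <-; rewrite wtU eqxx.
Qed.

Lemma wsupp_pderiv (Q Q' : int -> bool) i p : (forall z, Q z -> Q' (z - (w i)%:Z)) ->
  wsupp Q p -> wsupp Q' (pderiv i p).
Proof.
move=> QQ' Qp m Qm; rewrite mcoeff_pderiv Qp ?mul0rn//; apply: contra Qm => /QQ'.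
by rewrite wtM wtU PoszD addrC addKr.
Qed.

Definition homog (n : int) := wsupp (fun z => z == n).

Lemma wsupp_lowers_pderiv i : forall n p,
  wsupp (fun z => z < n) p -> wsupp (fun z => z < n - (w i)%:Z) (pderiv i p).
Proof. by move=> n p; apply: wsupp_pderiv => z; rewrite ltrBlDr subrK. Qed.

Lemma wsupp_exists_below p : exists n : nat, wsupp (fun z => z < n%:Z) p.
Proof.
exists (\max_(m <- msupp p) (wt m).+1)%N => m; rewrite -leNgt lez_nat => le.
apply: mcoeff_outdom; apply/negP => ms.
by have := leq_trans (@leq_bigmax_seq _ _ xpredT (fun m => (wt m).+1) m ms isT) le; rewrite ltnn.
Qed.

Definition malg_filtered : filtered F.
Proof.
refine (@Filtered F P (fun n => wsupp (fun z => z < n)) _ _ _ _ wsupp_exists_below).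
- by move=> n c p q; exact: wsupp_lin.
- by move=> n n' p nn'; apply: wsuppW => z zn; exact: lt_le_trans nn'.
- by move=> n p n0 h; apply/malgP => m; rewrite mcoeff0 h// -leNgt (le_trans n0).
- by move=> n; exact: wsupp0.
Defined.

End Weight.
End Polynomials.

Section MalgWeyl.

Variables (F : numFieldType) (N : nat) (wa : 'I_N -> nat).

Definition malg_weyl : weyl F wa.
Proof.
refine (@Weyl F N wa (malg_filtered F (vwt wa))
  (fun i => @pderiv F _ i) (fun i p => tvar F i * p) _ _ _ _ _).
- by move=> i; split; [exact: linear_pderiv|exact: wsupp_lowers_pderiv].
- move=> i; split=> [|n p]; first exact: linear_mull.
  by apply: wsupp_tvarM => z; rewrite opprK ltrD2r.
- by move=> i j; exact: pderivC.
- by move=> i j p; exact: mulrCA.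
- by move=> i j p; exact: pderiv_tvarM.
Defined.

End MalgWeyl.

(** * Products of solutions of the Virasoro constraints *)

Section ProductOfTauFunctions.

Variables (F : numFieldType) (N : nat) (wa : 'I_N -> nat) (W : weyl F wa).
Hypothesis wa_gt0 : forall a, (0 < wa a)%N.

Variables (mu : W -> W -> W) (one : W).
Hypothesis linear_mul : forall q, linear (mu^~ q).
Hypothesis linear_mur : forall p, linear (mu p).
Hypothesis pd_mu : forall i p q, pd i (mu p q) = mu (pd i p) q + mu p (pd i q).
Hypothesis tm_mul : forall i p q, tm i (mu p q) = mu (tm i p) q.
Hypothesis tm_mur : forall i p q, tm i (mu p q) = mu p (tm i q).
Hypothesis pd_one : forall i, pd i one = 0.

(** [g a n] stands for the hbar^n coefficient of the a-th factor at hbar s_a. The constraint is kept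
    multiplied by s_a, a form that makes sense at s_a = 0. *)
Variables (al : 'I_N -> nat) (s : 'I_N -> F) (g : 'I_N -> nat -> W).
Hypothesis g_free : forall a b k n, b != a -> pd (b, k) (g a n) = 0.
Hypothesis g_vir : forall a k n, (0 < k)%N ->
  s a *: Lv a k (g a n) = (dfact (k + al a + 1))%:R *: pd (a, (k + al a)%N) (g a n.+1).
Hypothesis g0_const : forall a i, pd i (g a 0) = 0.
Hypothesis g_const : forall a i n, s a = 0 -> pd i (g a n) = 0.

Definition conv (f h : nat -> W) : nat -> W :=
  fun n => \sum_(i < n.+1) mu (f i) (h (n - i)%N).
Definition conv1 : nat -> W := fun n => one *+ (n == 0%N).

Local Notation G r := (\big[conv/conv1]_(a <- r) g a).

Lemma linear_Lv a k : linear (@Lv _ _ _ W a k).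
Proof. by case: (lowers_Lv W wa_gt0 a k). Qed.

Lemma pd0 i : pd i (0 : W) = 0. Proof. exact: (linop0 (linear_pd (W:=W) i)). Qed.
Lemma mul0 q : mu 0 q = 0. Proof. exact: (linop0 (linear_mul q)). Qed.
Lemma mur0 p : mu p 0 = 0. Proof. exact: (linop0 (linear_mur p)). Qed.

Lemma Lv_mul a k p q : (forall l, pd (a, l) q = 0) -> Lv a k (mu p q) = mu (Lv a k p) q.
Proof.
move=> q0; apply/esym; apply: (@Lv_commutes _ _ _ W wa_gt0 (mu^~ q)) => // i p'.
  by rewrite pd_mu q0 mur0 addr0.
by rewrite tm_mul.
Qed.

Lemma Lv_mur a k p q : (forall l, pd (a, l) p = 0) -> Lv a k (mu p q) = mu p (Lv a k q).
Proof.
move=> p0; apply/esym; apply: (@Lv_commutes _ _ _ W wa_gt0 (mu p)) => // i q'.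
  by rewrite pd_mu p0 mul0 add0r.
by rewrite tm_mur.
Qed.

Lemma prod_free r a k n : a \notin r -> pd (a, k) (G r n) = 0.
Proof.
elim: r n => [|b r IH] n.
  by rewrite big_nil /conv1; case: (n == 0%N); rewrite ?mulr1n ?mulr0n ?pd_one ?pd0.
rewrite inE negb_or big_cons => /andP[ab ar].
rewrite /conv (linop_sum (linear_pd (W:=W) _)) big1// => i _.
by rewrite pd_mu g_free// IH// mul0 mur0 addr0.
Qed.

Lemma prod0_const r i : pd i (G r 0) = 0.
Proof.
elim: r => [|b r IH]; first by rewrite big_nil.
by rewrite big_cons /conv big_ord1 pd_mu g0_const IH mul0 mur0 addr0.
Qed.

Lemma prod_const r a k n : s a = 0 -> pd (a, k) (G r n) = 0.
Proof.
move=> sa; elim: r n => [|b r IH] n.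
  by rewrite big_nil /conv1; case: (n == 0%N); rewrite ?mulr1n ?mulr0n ?pd_one ?pd0.
rewrite big_cons /conv (linop_sum (linear_pd (W:=W) _)) big1// => i _.
rewrite pd_mu IH mur0 addr0; have [<-|ab] := eqVneq a b.
  by rewrite g_const// mul0.
by rewrite g_free// mul0.
Qed.

(** L^a_k sees only the factor [a]. The convolution in degree n + 1 has one term more than in degree
    n; that term contains a derivative of an hbar^0 coefficient and vanishes. *)
Lemma prod_vir r a k n : uniq r -> a \in r -> (0 < k)%N ->
  s a *: Lv a k (G r n) = (dfact (k + al a + 1))%:R *: pd (a, (k + al a)%N) (G r n.+1).
Proof.
move=> + + k0; elim: r n => // b r IH n /= /andP[br ur].
have lL := linear_Lv a k; have lp := linear_pd (W:=W) (a, (k + al a)%N).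
rewrite inE big_cons /conv (linop_sum lL) (linop_sum lp) !scaler_sumr.
case: eqVneq => [ab _|ab /= ar].
  rewrite [RHS]big_ord_recl /= pd_mu g0_const mul0 add0r ab prod_free// mur0 scaler0 add0r.
  apply: eq_bigr => i _; rewrite Lv_mul => [|l]; last exact: prod_free.
  rewrite -(linopZ (linear_mul _)) g_vir// (linopZ (linear_mul _)) pd_mu.
  by rewrite (prod_free _ _ br) mur0 addr0 /bump /= add1n subSS.
rewrite [RHS]big_ord_recr /= pd_mu subnn prod0_const mur0 addr0 g_free// mul0 scaler0 addr0.
apply: eq_bigr => i _; rewrite Lv_mur => [|l]; last exact: g_free.
rewrite -(linopZ (linear_mur _)) IH// (linopZ (linear_mur _)) pd_mu g_free// mul0 add0r.
by rewrite subSn // -ltnS.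
Qed.

Definition prodtau : int -> W := laurent (\big[conv/conv1]_(a < N) g a).

Lemma pd_prodtau_const a k e : s a = 0 -> pd (a, k) (prodtau e) = 0.
Proof.
move=> sa; case: e => n /=; first exact: prod_const.
exact: pd0.
Qed.

(** If s_a = 0, every derivative in the family [a] vanishes, and every term of L_k with k >= 1
    contains one, so both sides are 0. *)
Lemma Lv_prodtau a k e : (0 < k)%N ->
  Lv a k (prodtau e)
  = ((s a)^-1 * (dfact (k + al a + 1))%:R) *: pd (a, (k + al a)%N) (prodtau (e + 1)).
Proof.
move=> k0; have lL := linear_Lv a k; have lp := linear_pd (W:=W).
have [sa|sa] := eqVneq (s a) 0.
  rewrite sa invr0 mul0r scale0r /Lv fsbig1 => [|j _].
    rewrite add0r big1 ?scaler0// => i _; rewrite big1// => j _.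
    by rewrite pd_prodtau_const// pd0 scaler0.
  by rewrite pd_prodtau_const// (linop0 (linear_tm (W:=W) _)) scaler0.
suff : s a *: Lv a k (prodtau e)
    = (dfact (k + al a + 1))%:R *: pd (a, (k + al a)%N) (prodtau (e + 1)).
  by move=> /(congr1 ( *:%R (s a)^-1)); rewrite !scalerA mulVf// scale1r.
case: e => n; last first.
  rewrite /= (linop0 lL) scaler0.
  (* At e = -1 the right side differentiates the constant hbar^0 coefficient; for smaller e both
     sides are zero. *)
  have [->|] : (Negz n + 1 = 0 :> int) \/ exists m, Negz n + 1 = Negz m.
    by case: n => [|n]; [left|right; exists n; rewrite !NegzE; lia].
    by rewrite /prodtau /= prod0_const scaler0.
  by move=> [m ->] /=; rewrite pd0 scaler0.
have -> : n%:Z + 1 = n.+1%:Z by lia.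
by apply: prod_vir => //; rewrite ?index_enum_uniq// mem_index_enum.
Qed.

Variables (chi DT : 'I_N -> nat -> F).

Lemma vtot_prodtau (e : int) :
  vtot chi (prodtau e)
  = ddir (fun a l => if (al a < l)%N
       then (s a)^-1 * (dfact l.+1)%:R * chi a (l - al a)%N else 0) (prodtau (e + 1)).
Proof.
have [K0 [b1 b2]] := exists_below2 (prodtau e) (prodtau (e + 1)).
(* The sums are matched by l = k + alpha_a, so the cut K for l must leave K - alpha_a above the
   weight bound for every [a]. *)
pose A := (\max_a al a)%N; pose K := (K0 + A)%N.
have bK : below K%:Z (prodtau (e + 1)) by apply: below_le b2; rewrite /K; lia.
rewrite /ddir (locfin_fsum (locfin_ddir (W := W) wa_gt0 _) bK) exchange_big/=.
apply: eq_bigr => a _; rewrite /va.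
have Aa : (al a <= A)%N by exact: leq_bigmax.
rewrite (locfin_fsum_pos (locfin_va (W := W) wa_gt0 _ _) (K := (K - al a)%N)).
  rewrite -(big_mkord (fun k => 0 < k)%N (fun k => chi a k *: Lv a k (prodtau e))).
  rewrite -(big_mkord xpredT (fun l => (if (al a < l)%N
       then (s a)^-1 * (dfact l.+1)%:R * chi a (l - al a)%N else 0) *: pd (a, l) (prodtau (e + 1)))).
  rewrite [RHS](@big_cat_nat _ _ _ (al a))//=; last by rewrite /K; lia.
  rewrite [X in _ = X + _]big_nat_cond [X in _ = X + _]big1 ?add0r => [|l /andP[/andP[_ la] _]].
    have shift (h : nat -> W) :
        \sum_(al a <= l < K) h l = \sum_(0 <= k < K - al a) h (k + al a)%N.
      by rewrite -{1}[al a]add0n big_addn.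
    rewrite shift big_mkcond/=; apply: eq_big_nat => k _.
    rewrite -[X in (al a < X)%N]addnC -{1}[al a]addn0 ltn_add2l; case: ifP => k0; last by rewrite scale0r.
    by rewrite Lv_prodtau// scalerA addnK addn1; congr (_ *: _); ring.
  by rewrite ltnNge ltnW//= scale0r.
by apply: below_le b1; rewrite /K; lia.
Qed.

Hypothesis DT_small : forall a k, (k <= al a)%N -> DT a k = 0.

Lemma ddir_prodtau (e : int) :
  ddir DT (prodtau e)
  = ddir (fun a k => if (al a < k)%N then s a / s a * DT a k else 0) (prodtau e).
Proof.
rewrite /ddir; apply: eq_fsbigr => k _; apply: eq_bigr => a _.
have [sa|sa] := eqVneq (s a) 0; first by rewrite pd_prodtau_const// !scaler0.
by case: ltnP => ak; [rewrite mulfV// mul1r|rewrite DT_small].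
Qed.

End ProductOfTauFunctions.

(** * Homogeneity of the tau-functions *)

Section TauFunction.

Variables (F : numFieldType) (al wa : nat) (tau : nat -> {malg F[{cmonom nat}]}).
Hypothesis wa_gt0 : (0 < wa)%N.
Hypothesis tauP : is_tau al tau.

Local Notation P := {malg F[{cmonom nat}]}.
Local Notation w := (fun k : nat => wa * k.*2.+1)%N.
Local Notation d := al.*2.+1.

Lemma homog_tvarM n n' i (p : P) : n' = n + (w i)%:Z ->
  homog w n p -> homog w n' (tvar F i * p).
Proof. by move=> ->; apply: wsupp_tvarM => z /eqP ->. Qed.

Lemma homog_pderiv n n' i (p : P) : n' = n - (w i)%:Z ->
  homog w n p -> homog w n' (pderiv i p).
Proof. by move=> ->; apply: wsupp_pderiv => z /eqP ->. Qed.

Lemma homog_dT n n' l (p : P) : n' = n - wa%:Z * (2 * l + 1) ->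
  homog w n p -> homog w n' (dT id l p).
Proof.
case: l => l e hp; last exact: wsupp0.
by apply: homog_pderiv hp; rewrite e; lia.
Qed.

Lemma homog_Lvir n n' k (p : P) : n' = n - wa%:Z * (2 * k) ->
  homog w n p -> homog w n' (Lvir id k p).
Proof.
move=> -> hp; apply: wsuppD; first apply: wsuppD.
- apply: wsuppZ; apply: wsupp_sum => i _; apply: wsupp_sum => j /eqP ij.
  apply: wsuppZ; have -> : tvar F (id (nat_of_ord i)) * tvar F (id (nat_of_ord j)) * p
      = tvar F (nat_of_ord i) * (tvar F (nat_of_ord j) * p) by exact: esym (mulrA _ _ _).
  apply: (homog_tvarM (n := n + (w j)%:Z)); last exact: homog_tvarM hp.
  move: ij; move: (nat_of_ord i) (nat_of_ord j) => u v ij.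
  have -> : k = - (u%:Z + v%:Z + 1) by lia.
  by nia.
- apply: wsupp_sum => j _; apply: wsuppZ.
  apply: (homog_tvarM (n := n - wa%:Z * (2 * (j%:Z + k) + 1))); last exact: homog_dT hp.
  by rewrite /=; nia.
- apply: wsuppZ; apply: wsupp_sum => i _; apply: wsupp_sum => j /eqP ij.
  apply: wsuppZ; apply: (homog_dT (n := n - wa%:Z * (2 * j%:Z + 1))); last exact: homog_dT hp.
  move: ij; move: (nat_of_ord i) (nat_of_ord j) => u v ij.
  have -> : k = u%:Z + v%:Z + 1 by lia.
  by nia.
Qed.

Lemma solve_constraint (V : lmodType F) (A B C : V) (c : F) :
  c != 0 -> A - c *: B + C = 0 -> B = c^-1 *: (A + C).
Proof.
move=> c0; rewrite addrAC => /eqP; rewrite subr_eq0 => /eqP ->.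
by rewrite scalerA mulVf// scale1r.
Qed.

Lemma solve_constraint2 (V : lmodType F) (A B C : V) (c : F) :
  2%:R^-1 *: A - (c / 2%:R) *: B + (false%:R / 16%:R) *: C = 0 -> A = c *: B.
Proof.
rewrite mul0r scale0r addr0 => /eqP; rewrite subr_eq0 => /eqP /(congr1 ( *:%R 2%:R)).
by rewrite !scalerA mulfV ?pnatr_eq0// scale1r mulrCA mulfV ?pnatr_eq0// mulr1.
Qed.

Lemma dfact_neq0 n : (dfact n)%:R != 0 :> F.
Proof. by rewrite pnatr_eq0 -lt0n prodn_gt0. Qed.

Lemma tau_constraint (k l e e' : int) : k + al%:Z = l -> e + 1 = e' -> - al%:Z <= k ->
  2%:R^-1 *: Lvir id k (laurent tau e)
  - ((dfact (absz (l + 1)))%:R / 2%:R) *: dT id l (laurent tau e')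
  + ((k == 0)%:R / 16%:R) *: laurent tau e = 0.
Proof. by move=> <- <- k0; exact: (tauP.2 k k0 e). Qed.

(** The indices k = j - alpha with k >= - alpha are exactly those with j >= 0, so every derivative
    is reached. *)
Lemma pderiv_tau (e : int) (j : nat) :
  pderiv j (laurent tau (e + 1)) = ((dfact (j + 1))%:R / 2%:R)^-1 *:
   (2%:R^-1 *: Lvir id (j%:Z - al%:Z) (laurent tau e)
     + ((j%:Z - al%:Z == 0)%:R / 16%:R) *: laurent tau e).
Proof.
apply: solve_constraint; first by rewrite mulf_neq0 ?dfact_neq0// invr_eq0 pnatr_eq0.
have kl : j%:Z - al%:Z + al%:Z = j%:Z by lia.
have k0 : - al%:Z <= j%:Z - al%:Z by lia.
exact: (tau_constraint kl erefl k0).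
Qed.

(** The coefficient of a nonconstant monomial is recovered, up to a nonzero integer, from the
    derivative in a variable dividing it; the constant term is fixed by the normalization. *)
Lemma homog_tau_step (e : int) :
  -1 <= e -> homog w ((wa * d)%:Z * e) (laurent tau e) ->
  homog w ((wa * d)%:Z * (e + 1)) (laurent tau (e + 1)).
Proof.
move=> e1 he.
have hD j : homog w ((wa * d)%:Z * (e + 1) - (w j)%:Z) (pderiv j (laurent tau (e + 1))).
  rewrite pderiv_tau; apply: wsuppZ; apply: wsuppD; first apply: wsuppZ.
    by apply: homog_Lvir he; nia.
  have [j0|j0] := eqVneq (j%:Z - al%:Z) 0.
    apply: wsuppZ; have -> // : (wa * d)%:Z * (e + 1) - (w j)%:Z = (wa * d)%:Z * e by nia.
  by rewrite mul0r scale0r; exact: wsupp0.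
move=> m wm; have [m1|[i im]] := fset_0Vmem (finsupp m).
  have {m1}m1 : m = mone.
    by apply/eqP/cmP => j; rewrite cm1; apply/eqP; rewrite cmE_eq0 m1 in_fset0.
  have [n en] : exists n : nat, e + 1 = n%:Z by exists (absz (e + 1)); lia.
  rewrite en m1 /=; apply: etrans (tauP.1 n) _.
  case: n en => // en; rewrite en mulr0 m1 /wt mdom1 big_seq_fset0 eqxx// in wm.
have mi : (m i != 0)%N by rewrite cmE_neq0.
have em : mmul (ucm i) (divcm m (ucm i)) = m.
  apply/eqP/cmP => j; rewrite cmM divcmE cmU.
  by case: (i =P j) => [ij|_]; rewrite ?subn0// -ij; lia.
have wm' : wt w (divcm m (ucm i)) != (wa * d)%:Z * (e + 1) - (w i)%:Z :> int.
  by move: wm; rewrite -{1}em wtM wtU; lia.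
have := etrans (esym (mcoeff_pderiv i (laurent tau (e + 1)) (divcm m (ucm i)))) (hD i _ wm').
by rewrite em => /eqP; rewrite mulrn_eq0 => /eqP.
Qed.

Lemma homog_tau n : homog w (wa * d * n)%:Z (tau n).
Proof.
elim: n => [|n IH].
  (* The step is started from the zero coefficient at e = -1, which yields the case hbar^0. *)
  have h0 : homog w ((wa * d)%:Z * -1) (laurent tau (-1)) by exact: wsupp0.
  have := homog_tau_step (isT : -1 <= -1 :> int) h0.
  by have -> : (wa * d)%:Z * (-1 + 1) = (wa * d * 0)%:Z by lia.
have e1 : -1 <= n%:Z :> int by lia.
have h0 : homog w ((wa * d)%:Z * n%:Z) (laurent tau n).
  by have -> : (wa * d)%:Z * n%:Z = (wa * d * n)%:Z by lia.
have := homog_tau_step e1 h0; have -> : n%:Z + 1 = n.+1%:Z by lia.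
by have -> : (wa * d)%:Z * n.+1%:Z = (wa * d * n.+1)%:Z by lia.
Qed.

Lemma pderiv_tau0 j : pderiv j (tau 0) = 0.
Proof.
apply/malgP => m; apply: etrans (mcoeff_pderiv j (tau 0) m) _.
rewrite mcoeff0 (@homog_tau 0) ?mul0rn// wtM wtU.
by apply/eqP; nia.
Qed.

Lemma Lvir_tau (k n : nat) : (0 < k)%N ->
  Lvir id k%:Z (tau n) = (dfact (k + al + 1))%:R *: pderiv (k + al)%N (tau n.+1).
Proof.
clear wa_gt0; move=> k0; have e1 : n%:Z + 1 = n.+1%:Z by lia.
have k1 : - al%:Z <= k%:Z by lia.
have := @tau_constraint k%:Z (k + al)%N%:Z n%:Z n.+1%:Z erefl e1 k1.
have -> : (k%:Z == 0) = false by apply/negbTE; lia.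
exact: solve_constraint2.
Qed.

End TauFunction.

(** * Substitution of variables *)

Lemma cmonom_ind (I : choiceType) (Pr : {cmonom I} -> Prop) : Pr mone ->
  (forall i m, Pr m -> Pr (mmul (ucm i) m)) -> forall m, Pr m.
Proof.
move=> P1 PM m; have [n] := ubnP (mdeg m); elim: n m => // n IH m mn.
have [m1|[i im]] := fset_0Vmem (finsupp m).
  have -> // : m = mone.
  by apply/eqP/cmP => j; rewrite cm1; apply/eqP; rewrite cmE_eq0 m1 in_fset0.
have mi : (m i != 0)%N by rewrite cmE_neq0.
have em : mmul (ucm i) (divcm m (ucm i)) = m.
  apply/eqP/cmP => j; rewrite cmM divcmE cmU.
  by case: (i =P j) => [ij|_]; rewrite ?subn0// -ij; lia.
rewrite -em; apply: PM; apply: IH.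
by move: mn; rewrite -{1}em mdegM mdegU; lia.
Qed.

Section MonomialEvaluation.

Variables (S : comNzRingType) (t : nat -> S).
Implicit Types m : {cmonom nat}.

Definition meval m : S := \prod_(k <- finsupp m) t k ^+ m k.

Lemma mevalEw m (d : {fset nat}) : (finsupp m `<=` d)%fset ->
  meval m = \prod_(k <- d) t k ^+ m k.
Proof.
move=> le; rewrite /meval (big_fset_incl _ le)//= => i _.
by rewrite -cmE_eq0 => /eqP ->; rewrite expr0.
Qed.

Lemma mevalM m m' : meval (mmul m m') = meval m * meval m'.
Proof.
rewrite (@mevalEw m (finsupp m `|` finsupp m')%fset) ?fsubsetUl//.
rewrite (@mevalEw m' (finsupp m `|` finsupp m')%fset) ?fsubsetUr//.
rewrite /meval mdomD -big_split/=; apply: eq_bigr => i _.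
by rewrite cmM exprD.
Qed.

Lemma mevalU k : meval (ucm k) = t k.
Proof. by rewrite /meval mdomU big_seq_fset1 cmUU expr1. Qed.

Lemma meval1 : meval mone = 1.
Proof. by rewrite /meval mdom1 big_seq_fset0. Qed.

End MonomialEvaluation.

Section LinearExtension.

Variables (F : numFieldType) (I : choiceType) (V : lmodType F) (h : {cmonom I} -> V).

Local Notation P := {malg F[{cmonom I}]}.

(** [subst_vars] has this form, which gives its linearity and reduces its properties to
    monomials. *)
Definition linext (p : P) : V := \sum_(m <- msupp p) p@_m *: h m.

Lemma linextEw (d : {fset {cmonom I}}) p : (msupp p `<=` d)%fset ->
  linext p = \sum_(m <- d) p@_m *: h m.
Proof.
move=> le; rewrite /linext (big_fset_incl _ le)//= => m _ /mcoeff_outdom ->.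
exact: scale0r.
Qed.

Lemma linear_linext : linear linext.
Proof.
move=> c p q; pose d := (msupp p `|` msupp q `|` msupp (c *: p + q))%fset.
rewrite (@linextEw d (c *: p + q)) ?fsubsetUr// (@linextEw d p); last first.
  by apply: fsubset_trans (fsubsetUl _ _); exact: fsubsetUl.
rewrite (@linextEw d q); last first.
  by apply: fsubset_trans (fsubsetUl _ _); exact: fsubsetUr.
rewrite scaler_sumr -big_split /=; apply: eq_bigr => m _.
by rewrite mcoeff_lin scalerDl scalerA.
Qed.

Lemma linextU m : linext << m >> = h m.
Proof. by rewrite /linext msuppU1 big_seq_fset1 mcoeffUU scale1r. Qed.

End LinearExtension.

Section Substitution.

Variables (F : numFieldType) (I : choiceType) (x : nat -> I).
Hypothesis x_inj : injective x.

Local Notation P := {malg F[{cmonom nat}]}.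
Local Notation Q := {malg F[{cmonom I}]}.
Local Notation h := (@meval Q (fun k => tvar F (x k))).
Local Notation S := (@subst_vars F I x).

Lemma subst_linext p : S p = linext (h : _ -> Q) p.
Proof. by apply: eq_bigr => m _; exact: mul_malgC. Qed.

Lemma linear_subst : linear (S : P -> Q).
Proof.
move=> c p q; rewrite (subst_linext (c *: p + q)) (subst_linext p) (subst_linext q).
exact: linear_linext.
Qed.

Lemma substU m : S << m >> = h m.
Proof. by rewrite subst_linext; exact: linextU. Qed.

Lemma subst_tvarM k p : S (tvar F k * p) = tvar F (x k) * S p.
Proof.
move: p; apply: (@malg_linop_ext F _ Q (fun p => S (tvar F k * p)) (fun p => tvar F (x k) * S p)).
- exact: (linop_comp linear_subst (linear_mull _)).
- exact: (linop_comp (linear_mull _) linear_subst).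
move=> m; have e1 : tvar F k * (<< m >> : P) = << mmul (ucm k) m >> by exact: malgUM.
apply: etrans (congr1 S e1) _.
apply: etrans (substU _) _; apply: etrans (mevalM _ _ _) _.
exact: (congr2 *%R (mevalU _ _) (esym (substU m))).
Qed.

Lemma meval_cons k m : h (mmul (ucm k) m) = tvar F (x k) * h m.
Proof. by apply: etrans (mevalM _ _ _) _; rewrite mevalU. Qed.

Lemma subst_pderiv l p : S (pderiv l p) = pderiv (x l) (S p).
Proof.
move: p; apply: (@malg_linop_ext F _ Q (fun p => S (pderiv l p)) (fun p => pderiv (x l) (S p))).
- exact: (linop_comp linear_subst (linear_pderiv _)).
- exact: (linop_comp (linear_pderiv _) linear_subst).
apply: cmonom_ind => [|k m IH].
  rewrite (substU mone) meval1 (pderiv1 F (x l)).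
  by apply: etrans (congr1 S (pderiv1 F l)) _; exact: (linop0 linear_subst).
have e1 : (<< mmul (ucm k) m >> : P) = tvar F k * << m >> by apply/esym; exact: malgUM.
rewrite e1 (subst_tvarM k << m >>).
apply: etrans (congr1 S (pderiv_tvarM l k << m >>)) _.
apply: etrans (linopD linear_subst _ _) _.
apply/esym; apply: etrans (pderiv_tvarM _ _ _) _; apply/esym.
apply: (congr2 +%R).
  apply: etrans (linopZ linear_subst _ _) _.
  exact: (congr1 (fun b : bool => b%:R *: S << m >>) (esym (inj_eq x_inj l k))).
by rewrite (subst_tvarM k) IH.
Qed.

Lemma subst_pderiv0 i p : (forall k, x k != i) -> pderiv i (S p) = 0.
Proof.
move=> xi; move: p; apply: (@malg_linop_ext F _ Q (fun p => pderiv i (S p)) (fun=> 0)).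
- exact: (linop_comp (linear_pderiv _) linear_subst).
- by move=> c p q; rewrite scaler0 addr0.
apply: cmonom_ind => [|k m IH].
  by rewrite (substU mone) meval1 (pderiv1 F i).
have e1 : (<< mmul (ucm k) m >> : P) = tvar F k * << m >> by apply/esym; exact: malgUM.
rewrite e1 (subst_tvarM k << m >>); apply: etrans (pderiv_tvarM _ _ _) _.
by rewrite IH mulr0 addr0 eq_sym (negPf (xi k)) scale0r.
Qed.

Lemma wsupp_subst (w : I -> nat) (T : int -> bool) p :
  wsupp (fun k => w (x k)) T p -> wsupp w T (S p).
Proof.
move=> hp; rewrite subst_linext; apply: wsupp_sum => m _.
have hm : homog w (wt (fun k => w (x k)) m)%:Z (h m).
  elim/cmonom_ind: m => [|k m IH].
    rewrite meval1 => m wm; rewrite mcoeff1; case: (m =P mone) wm => // ->.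
    by rewrite /wt !mdom1 !big_seq_fset0.
  rewrite meval_cons; apply: wsupp_tvarM IH => z /eqP ->.
  by rewrite wtM wtU; lia.
have [Tm|/hp ->] := boolP (T (wt (fun k => w (x k)) m)%:Z).
  by apply: wsuppZ; apply: wsuppW hm => z /eqP ->.
by rewrite scale0r; exact: wsupp0.
Qed.

Lemma subst_Lvir k p : (0 < k)%N -> S (Lvir id k%:Z p) = Lvir x k%:Z (S p).
Proof.
move=> k0; rewrite /Lvir; apply: etrans (linopD linear_subst _ _) _.
have no (i j : 'I_k) : (i%:Z + j%:Z == - k%:Z - 1) = false by apply/negbTE; lia.
apply: (congr2 +%R).
  apply: etrans (linopD linear_subst _ _) _; apply: (congr2 +%R).
    apply: etrans (linopZ linear_subst _ _) _; apply: (congr1 ( *:%R _)).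
    apply: etrans (linop_sum linear_subst _ _ _) _; apply: eq_bigr => i _.
    apply: etrans (linop_sum linear_subst _ _ _) _; apply: eq_bigr => j.
    by rewrite no.
  (* The weight k + 1 is auxiliary: it only bounds the indices of the variables occurring in [p]. *)
  have [K bK] := wsupp_exists_below (fun k => k.+1) p.
  have z j : (K <= j)%N -> pderiv j p = 0.
    move=> Kj; apply/malgP => m; apply: etrans (mcoeff_pderiv _ _ _) _.
    rewrite mcoeff0 bK ?mul0rn// wtM wtU; lia.
  rewrite (@fsum_trunc _ _ K) => [|j Kj]; last first.
    have -> : dT id (j%:Z + k%:Z) p = 0 by apply: z; lia.
    by rewrite mulr0 scaler0.
  rewrite (@fsum_trunc _ _ K) => [|j Kj]; last first.
    have -> : dT x (j%:Z + k%:Z) (S p) = 0.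
      apply: etrans (esym (subst_pderiv (j + k)%N p)) _.
      by rewrite z; [exact: (linop0 linear_subst)|lia].
    by rewrite mulr0 scaler0.
  apply: etrans (linop_sum linear_subst _ _ _) _; apply: eq_bigr => j _.
  apply: etrans (linopZ linear_subst _ _) _; apply: (congr1 ( *:%R _)).
  apply: etrans (subst_tvarM _ _) _; apply: (congr1 ( *%R _)).
  exact: subst_pderiv.
apply: etrans (linopZ linear_subst _ _) _; apply: (congr1 ( *:%R _)).
apply: etrans (linop_sum linear_subst _ _ _) _; apply: eq_bigr => i _.
apply: etrans (linop_sum linear_subst _ _ _) _; apply: eq_bigr => j _.
apply: etrans (linopZ linear_subst _ _) _; apply: (congr1 ( *:%R _)).
by apply: etrans (subst_pderiv _ _) _; apply: (congr1 (pderiv _)); exact: subst_pderiv.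
Qed.

End Substitution.

(** * The operators of the theorem as lowering operators *)

Section QuadraticOperators.

Variables (F : numFieldType) (N : nat).

Local Notation CT := {malg F[{cmonom ('I_N * nat)%type}]}.

Lemma LvirE (wa : 'I_N -> nat) (a : 'I_N) (k : nat) (p : CT) : (0 < k)%N ->
  Lvir (fam a) k%:Z p = Lv (W := malg_weyl F wa) a k p.
Proof.
move=> k0.
have z : \sum_(i < `|k%:Z|%N) \sum_(j < `|k%:Z|%N | i%:Z + j%:Z == - k%:Z - 1)
    (dfact i * dfact j)%:R^-1 *: (tvar F (fam a i) * tvar F (fam a j) * p) = 0.
  apply: big1 => i _; apply: big1 => j /eqP ij; lia.
rewrite /Lvir; apply: etrans (congr1 (fun u => 2%:R^-1 *: u + _ + _) z) _.
apply: etrans (congr1 (fun u => u + _ + _) (scaler0 _ _)) _.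
by apply: etrans (congr1 (fun u => u + _) (add0r _)) _.
Qed.

Lemma vopE (wa : 'I_N -> nat) (c : nat -> F) (a : 'I_N) :
  vop c a = va (W := malg_weyl F wa) c a.
Proof.
apply/funext => p; rewrite /vop /va; apply: eq_fsbigr => k.
by rewrite inE /= => k0; rewrite (LvirE wa).
Qed.

(** With weight 2k + 1 in all families, the terms of r_k lower the weight by 2k: 2 (k + j) + 1
    against 2j + 1, and (2j + 1) + (2 (k - j - 1) + 1). *)
Lemma lowers_rop_weyl (W : weyl F (fun _ : 'I_N => 1%N)) (r : nat -> 'M[F]_N) :
  lowers 1 (fun p : W => \sum_(k \in [set k : nat | (0 < k)%N]) \sum_(a < N) \sum_(b < N)
    (\sum_(j \in [set: nat]) r k b a *: tm (a, j) (pd (b, (k + j)%N) p)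
     + 2%:R^-1 *: \sum_(j < k)
        ((-1) ^+ j.+1 * r k b a) *: pd (a, j : nat) (pd (b, (k - j - 1)%N) p))).
Proof.
have w1 (a : 'I_N) : (0 < (fun _ : 'I_N => 1%N) a)%N by [].
have low k : lowers k%:Z (fun p : W => \sum_(a < N) \sum_(b < N)
    (\sum_(j \in [set: nat]) r k b a *: tm (a, j) (pd (b, (k + j)%N) p)
     + 2%:R^-1 *: \sum_(j < k)
        ((-1) ^+ j.+1 * r k b a) *: pd (a, j : nat) (pd (b, (k - j - 1)%N) p))).
  apply: lowers_sum => a _; apply: lowers_sum => b _; apply: lowersD.
    apply: lowers_fsum => [j p bp|j].
      rewrite (@pd_eq0 _ _ _ W w1 b (k + j) j%:Z)//; last by lia.
      by rewrite (linop0 (linear_tm _)) scaler0.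
    apply: lowersZ; apply: lowersW (lowers_tmpd _ _ _ _ _).
    by rewrite /vwt /=; lia.
  apply: lowersZ; apply: lowers_sum => j _; apply: lowersZ.
  apply: lowersW (lowers_comp (lowers_pd _ _) (lowers_pd _ _)).
  by have := ltn_ord j; rewrite /vwt /=; lia.
apply: lowers_fsum_pos => [|k k0]; first exact: locfin_lowers.
by apply: lowersW (low k); lia.
Qed.

Lemma lowers_rop (r : nat -> 'M[F]_N) :
  @lowers F (malg_filtered F (vwt (fun _ : 'I_N => 1%N))) 1 (rop r).
Proof. exact: (lowers_rop_weyl (malg_weyl F (fun _ : 'I_N => 1%N)) r). Qed.

End QuadraticOperators.

(** * Operators acting on each power of hbar separately *)

Section OperatorsOnSeries.

Variables (F : numFieldType) (P : filtered F).

Lemma exp_op_hlift (A : P -> P) (f : int -> P) e :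
  exp_op (hlift A) f e = pexp A (f e).
Proof.
rewrite /exp_op /pexp; apply: eq_fsbigr => m _; congr (_ *: _).
by elim: m => // m IH; rewrite !iterS /hlift IH.
Qed.

Lemma bigcomp_hlift (J : Type) (s : seq J) (B : J -> P -> P) (f : int -> P) e :
  (\big[(fun A B => A \o B)/id]_(a <- s) exp_op (hlift (B a))) f e
  = (\big[(fun A B => A \o B)/id]_(a <- s) pexp (B a)) (f e).
Proof.
elim: s f e => [|a s IH] f e; first by rewrite !big_nil.
by rewrite !big_cons /= exp_op_hlift IH.
Qed.

End OperatorsOnSeries.

(** * The operators L_0 and Euler's identity *)

Section EulerOperator.

Variables (F : numFieldType) (N : nat) (wa : 'I_N -> nat).

Local Notation CT := {malg F[{cmonom ('I_N * nat)%type}]}.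
Implicit Types (p : CT) (m : {cmonom ('I_N * nat)%type}).

Lemma wt_pairs m (K : nat) : (forall a k, (K <= k)%N -> m (a, k) = 0%N) ->
  wt (vwt wa) m = (\sum_(a < N) \sum_(k < K) vwt wa (a, nat_of_ord k) * m (a, nat_of_ord k))%N.
Proof.
move=> mK; pose d := [fset ((x.1, nat_of_ord x.2) : 'I_N * nat) | x in {: 'I_N * 'I_K}]%fset.
rewrite (@wtEw _ _ m d); last first.
  apply/fsubsetP => -[a k] im; have kK : (k < K)%N.
    by rewrite ltnNge; apply/negP => /(mK a) e0; have := cmE_neq0 m (a, k); rewrite e0 im.
  by apply/imfsetP; exists (a, Ordinal kK).
rewrite big_imfset /=; last first.
  by move=> [a k] [b l] _ _ /= [-> kl]; congr (_, _); apply/val_inj.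
by rewrite big_enum /= pair_big.
Qed.

Lemma Lvir0E (a : 'I_N) p : Lvir (fam a) 0 p
  = \sum_(k \in [set: nat]) (k.*2.+1)%:R *: (tvar F (a, k) * pderiv (a, k) p).
Proof.
have drop (A B C : CT) (c : F) : A = 0 -> C = 0 -> c *: A + B + c *: C = B.
  by move=> -> ->; rewrite scaler0 add0r addr0.
rewrite /Lvir; apply: etrans (drop _ _ _ _ (big_ord0 _ _ _ _) (big_ord0 _ _ _ _)) _.
apply: eq_fsbigr => k _.
apply: (congr2 ( *:%R)).
  have -> : absz (k%:Z + 0 + 1) = k.+1 by lia.
  rewrite /dfact big_ord_recr /= natrM mulrAC mulfV ?mul1r// pnatr_eq0 -lt0n.
  by rewrite prodn_gt0.
have -> // : dT (fam a) (k%:Z + 0) p = pderiv (a, k) p.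
by have -> : k%:Z + 0 = k%:Z by lia.
Qed.

Hypothesis wa_gt0 : forall a, (0 < wa a)%N.

(** On a monomial the operator is the sum of the exponents times (2k + 1) / (2 alpha_a + 1), which
    is a third of its weight. *)
Lemma Euler_homog (al : 'I_N -> nat) (e : int) p :
  (forall a, (wa a * (al a).*2.+1 = 3)%N) -> homog (vwt wa) (3 * e) p ->
  \sum_(a < N) ((al a).*2.+1%:R)^-1 *: Lvir (fam a) 0 p = e%:~R *: p.
Proof.
move=> wal hp; have [K bK] := wsupp_exists_below (vwt wa) p.
have pd0K a k : (K <= k)%N -> pderiv (a, k) p = 0.
  move=> Kk; apply: (@pd_eq0 _ _ _ (malg_weyl F wa) wa_gt0 a k K%:Z); last exact: bK.
  by lia.
apply/malgP => m.
have L0 (a : 'I_N) : (Lvir (fam a) 0 p)@_m = (\sum_(k < K) (k.*2.+1 * m (a, nat_of_ord k)))%:R * p@_m.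
  rewrite Lvir0E (@fsum_trunc _ _ K) => [|k Kk]; last by rewrite pd0K// mulr0 scaler0.
  rewrite raddf_sum natr_sum mulr_suml; apply: eq_bigr => k _.
  apply: etrans (mcoeffZ _ _ _) _; rewrite natrM -mulrA.
  by apply: (congr1 ( *%R _)); exact: mcoeff_tvar_pderiv.
rewrite raddf_sum /=.
transitivity (\sum_(a < N) ((al a).*2.+1%:R)^-1 * ((\sum_(k < K) (k.*2.+1 * m (a, nat_of_ord k)))%:R * p@_m)).
  by apply: eq_bigr => a _; apply: etrans (mcoeffZ _ _ _) _; rewrite L0.
apply: etrans _ (esym (mcoeffZ _ _ _)).
have [me|/hp ->] := boolP ((wt (vwt wa) m)%:Z == 3 * e); last first.
  by rewrite mulr0 big1// => a _; rewrite !mulr0.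
have [pm|pm] := eqVneq p@_m 0.
  by rewrite pm mulr0 big1// => a _; rewrite !mulr0.
have mK a k : (K <= k)%N -> m (a, k) = 0%N.
  move=> Kk; apply/eqP; apply: contraT => mak; case/eqP: pm; apply: bK.
  rewrite -leNgt lez_nat; apply: leq_trans Kk _.
  rewrite /wt (big_fsetD1 (a, k)) -?cmE_neq0//=.
  apply: leq_trans (leq_addr _ _); rewrite -lt0n in mak.
  by apply: leq_trans (leq_pmulr _ mak); rewrite /vwt /=; have := wa_gt0 a; nia.
under eq_bigr => a _ do rewrite mulrA.
rewrite -mulr_suml; congr (_ * _).
have t0 : (3%:R : F) != 0 by rewrite pnatr_eq0.
(* Multiplying by 3 = [wa a] (2 alpha_a + 1) clears the denominators. *)
apply: (mulfI t0); rewrite mulr_sumr.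
have -> : 3%:R * e%:~R = ((3 * e)%:~R : F) by rewrite intrM.
rewrite -(eqP me) (wt_pairs mK) -pmulrn natr_sum; apply: eq_bigr => a _.
have d0 : ((al a).*2.+1%:R : F) != 0 by rewrite pnatr_eq0.
have -> : 3%:R = (wa a)%:R * (al a).*2.+1%:R :> F by rewrite -natrM wal.
rewrite mulrA mulfK// -natrM big_distrr /=; congr (_%:R)%R.
by apply: eq_bigr => k _; rewrite mulnA.
Qed.

End EulerOperator.

(** * The ancestor potential *)

Section AncestorPotential.

Variables (F : numFieldType) (N : nat).
Variables (tau : 'I_2 -> nat -> {malg F[{cmonom nat}]}) (alpha : 'I_N -> 'I_2).
Hypothesis tauP : forall al : 'I_2, is_tau al (tau al).
Variables (DT : 'I_N -> nat -> F) (s : 'I_N -> F) (chi : 'I_N -> nat -> F).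
Hypothesis DT0 : forall a, DT a 0%N = 0.
Hypothesis DT1 : forall a, alpha a = 1%N :> nat -> DT a 1%N = 0.
Hypothesis fser_exp : forall a,
  fser (s a) (alpha a) (DT a) = exp_field (chi a) (zser F).

Local Notation CT := {malg F[{cmonom ('I_N * nat)%type}]}.
Local Notation al := (fun a : 'I_N => nat_of_ord (alpha a)).

(* With T^a_k of weight 3 (2k + 1) / (2 alpha_a + 1), the hbar^e coefficient of
   the product of tau-functions is homogeneous of weight 3 e. *)
Definition awt (a : 'I_N) : nat := if alpha a == 0%N :> nat then 3 else 1.

Lemma awt_gt0 a : (0 < awt a)%N. Proof. by rewrite /awt; case: ifP. Qed.

Lemma awt_mul a : (awt a * (al a).*2.+1 = 3)%N.
Proof. by rewrite /awt; case: (alpha a) => -[|[|]]. Qed.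

Local Notation W := (malg_weyl F awt).
Local Notation g := (fun a n => s a ^+ n *: subst_vars (fam a) (tau (alpha a) n) : CT).

Lemma fam_inj (a : 'I_N) : injective (fam a).
Proof. by move=> k l []. Qed.

Lemma linear_fam (a : 'I_N) : linear (subst_vars (fam a) : {malg F[{cmonom nat}]} -> CT).
Proof. exact: linear_subst. Qed.

Lemma g_free a b k n : b != a -> pderiv (b, k) (g a n) = 0.
Proof.
move=> ba; apply: etrans (linopZ (linear_pderiv _) _ _) _.
rewrite subst_pderiv0 ?scaler0// => l; rewrite /fam xpair_eqE negb_and.
by rewrite eq_sym ba.
Qed.

Lemma g0_const a i : pderiv i (g a 0) = 0.
Proof.
apply: etrans (linopZ (linear_pderiv _) _ _) _.
case: i => b k; have [->|ba] := eqVneq b a; last first.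
  rewrite subst_pderiv0 ?scaler0// => l; rewrite /fam xpair_eqE negb_and.
  by rewrite eq_sym ba.
have e : pderiv (a, k) (subst_vars (fam a) (tau (alpha a) 0) : CT) = 0.
  apply: etrans (esym (subst_pderiv (@fam_inj a) k _)) _.
  rewrite (@pderiv_tau0 F (alpha a) 1 _ isT (tauP _)).
  exact: (linop0 (linear_fam a)).
by rewrite e scaler0.
Qed.

Lemma g_const a i n : s a = 0 -> pderiv i (g a n) = 0.
Proof.
move=> sa; case: n => [|n]; first exact: g0_const.
apply: etrans (linopZ (linear_pderiv _) _ _) _.
by rewrite sa expr0n /= scale0r.
Qed.

Lemma g_vir a k n : (0 < k)%N ->
  s a *: Lv (W := W) a k (g a n)
  = (dfact (k + al a + 1))%:R *: pderiv (a, (k + al a)%N) (g a n.+1).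
Proof.
move=> k0; apply: etrans (congr1 ( *:%R _) (esym (LvirE awt a (g a n) k0))) _.
have lL : linear (Lvir (fam a) k%:Z : CT -> CT).
  move=> c p q; rewrite (LvirE awt a (c *: p + q) k0) (LvirE awt a p k0) (LvirE awt a q k0).
  exact: (lowers_Lv W awt_gt0 a k).1.
apply: etrans (congr1 ( *:%R _) (linopZ lL _ _)) _.
apply: etrans (scalerA _ _ _) _; rewrite -exprS.
apply/esym; apply: etrans (congr1 ( *:%R _) (linopZ (linear_pderiv _) _ _)) _.
apply: etrans (scalerA _ _ _) _; rewrite mulrC; apply: etrans (esym (scalerA _ _ _)) _.
apply: (congr1 ( *:%R _)); apply/esym.
apply: etrans (esym (subst_Lvir (@fam_inj a) _ k0)) _.
rewrite (Lvir_tau (tauP (alpha a)) _ k0).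
apply: etrans (linopZ (linear_fam a) _ _) _; apply: (congr1 ( *:%R _)).
exact: (subst_pderiv (@fam_inj a)).
Qed.

Local Notation Phi := (Dhat_prod_tau s alpha tau).

Lemma PhiE : Phi = prodtau (W := W) ( *%R : W -> W -> W) (1 : CT) g.
Proof. exact: erefl. Qed.

Lemma homog_Phi (e : int) : homog (vwt awt) (3 * e) (Phi e).
Proof.
case: e => n; last exact: wsupp0.
rewrite /Dhat_prod_tau /laurent; move: (index_enum _) => r.
elim: r n => [|a r IH] n.
  rewrite big_nil /sone; case: n => [|n]; last exact: wsupp0.
  move=> m; rewrite mcoeff1; case: (m =P mone) => // ->.
  by rewrite /wt mdom1 big_seq_fset0.
rewrite big_cons; apply: wsupp_sum => i _.
apply: (@wsuppM _ _ _ (fun z => z == 3 * i%:Z) (fun z => z == 3 * (n - i)%:Z)) => [u v /eqP-> /eqP->||].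
- by have := ltn_ord i; lia.
- apply: wsuppZ; apply: wsupp_subst.
  have := @homog_tau F (alpha a) (awt a) _ (awt_gt0 a) (tauP (alpha a)) i.
  by rewrite awt_mul; apply: wsuppW => z; rewrite PoszM.
- exact: IH.
Qed.

Local Notation c := (fun a k => if (al a < k)%N then s a / s a * DT a k else 0).

Lemma pexp_vtot_Phi (e : int) :
  pexp (vtot (W := W) chi) (Phi e) = That DT Phi e.
Proof.
pose cs n a k := tcoef (s a) (al a) (chi a) n k.
(* Index 0 is excluded since T(z) has no constant term, index 1 by the condition imposed for alpha_a
   = 1. *)
have DT_small a k : (k <= al a)%N -> DT a k = 0.
  case: k => [|k] ka; first exact: DT0.
  have a1 : alpha a = 1%N :> nat by have := ltn_ord (alpha a); lia.
  by have -> : k = 0%N by [lia]; exact: DT1.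
have mul_l (q : W) : linear (fun p : W => (p * q : CT) : W) by exact: linear_mulr.
have mul_r (p : W) : linear (fun q : W => (p * q : CT) : W) by exact: linear_mull.
have tl i (p q : CT) : tvar F i * (p * q) = tvar F i * p * q by exact: mulrA.
have tr i (p q : CT) : tvar F i * (p * q) = p * (tvar F i * q) by exact: mulrCA.
have pM i (p q : CT) : pderiv i (p * q) = pderiv i p * q + p * pderiv i q.
  exact: pderivM.
rewrite PhiE.
have H := @pexp_vtot_translation F N awt W awt_gt0 chi cs _ _ _ c _
   (prodtau (W := W) ( *%R : W -> W -> W) (1 : CT) g) DT _ _ _ e.
rewrite H.
- rewrite /That /exp_op; apply: eq_fsbigr => j _; congr (_ *: _).
  elim: j e {H} => [|j IH] e; first by rewrite addr0.
  rewrite !iterS /=.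
  have -> : e + j.+1%:Z = e + 1 + j%:Z by lia.
  (* [ddir] also has the index k = 0, absent from [That]; its coefficient is 0. *)
  rewrite -IH /ddir; apply/esym; apply: fsbig_widen => // k [_ /= /negP].
  rewrite -eqn0Ngt => /eqP ->; apply: big1 => a _.
  by rewrite DT0 scale0r.
- by [].
- move=> n n0 a k; exact: tcoefS.
- move=> n a k /tcoef_wt; have := awt_mul a; have := awt_gt0 a.
  by rewrite /vwt /=; nia.
- move=> a k M kM; apply/esym; exact: sum_tcoef.
- by move=> e'; apply: wsuppW (@homog_Phi e') => z /eqP ->; rewrite ltrDl.
- move=> e'.
  have h := @vtot_prodtau F N awt W awt_gt0 ( *%R : W -> W -> W) (1 : CT) mul_l mul_r
    pM tl tr (@pderiv1 F _) al s g g_free g_vir g0_const g_const chi e'.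
  have cs1 : cs 1%N = fun a l => if (al a < l)%N
      then (s a)^-1 * (dfact l.+1)%:R * chi a (l - al a)%N else 0.
    by apply/funext => a; apply/funext => k; exact: tcoef1.
  exact: etrans h (congr1 (fun c' => ddir (W := W) c' _) (esym cs1)).
- move=> e'.
  exact: (@ddir_prodtau F N awt W ( *%R : W -> W -> W) (1 : CT) mul_l mul_r
    pM (@pderiv1 F _) al s g g_free g_const DT DT_small e').
Qed.

Lemma VhatE (f : int -> CT) e : Vhat chi f e = pexp (P := W) (vtot (W := W) chi) (f e).
Proof.
apply: etrans (@bigcomp_hlift F W _ _ (fun a => vop (chi a) a) f e) _.
apply: etrans (@bigcomp_pexp F W _ _ (fun a => vop (chi a) a) (f e) _ _) _.
- by move=> a; rewrite (vopE awt); exact: (lowers_va W awt_gt0).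
- move=> a b; rewrite !(vopE awt); have [->//|ab] := eqVneq a b.
  exact: (commutes_va awt_gt0).
have tot : (fun q : W => \sum_(a <- index_enum _) vop (chi a) a q) = vtot (W := W) chi.
  by apply/funext => q; apply: eq_bigr => a _; exact: (congr1 (fun A => A q) (vopE awt (chi a) a)).
exact: (congr1 (fun A => pexp (P := W) A (f e)) tot).
Qed.

Lemma Vhat_invE (f : int -> CT) e :
  Vhat_inv chi f e = pexp (P := W) (fun p => - vtot (W := W) chi p) (f e).
Proof.
have lV a : lowers 1 (va (W := W) (chi a) a) by exact: (lowers_va W awt_gt0).
apply: etrans (@bigcomp_hlift F W _ _ (fun a p => - vop (chi a) a p) f e) _.
apply: etrans (@bigcomp_pexp F W _ _ (fun a p => - vop (chi a) a p) (f e) _ _) _.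
- by move=> a; rewrite (vopE awt); exact: lowersN (lV a).
- move=> a b; rewrite (vopE awt (chi a)) (vopE awt (chi b)).
  apply: (commutes_opp (lV a).1 (lV b).1).
  by have [->//|ab] := eqVneq a b; exact: (commutes_va awt_gt0).
have tot : (fun q : W => \sum_(a <- index_enum _) - vop (chi a) a q)
    = (fun q : W => - vtot (W := W) chi q).
  apply/funext => q; apply: etrans (sumrN _ _ _) _; apply: (congr1 -%R).
  by apply: eq_bigr => a _; exact: (congr1 (fun A => A q) (vopE awt (chi a) a)).
exact: (congr1 (fun A => pexp (P := W) A (f e)) tot).
Qed.

Variable r : nat -> 'M[F]_N.

Local Notation R1 := (malg_filtered F (vwt (fun _ : 'I_N => 1%N))).

(** The inner exponential is finite for the weights [awt], the outer one for the weights 2k + 1;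
    both act on the same polynomials. *)
Lemma ZpotE e : Zpot r DT s alpha tau e
  = pexp (P := R1) (rop r)
      (pexp (P := W) (vtot (W := W) chi) (Phi e)).
Proof. by rewrite pexp_vtot_Phi; exact: (exp_op_hlift (P := R1)). Qed.

(** The inverses strip R and V from Z one coefficient at a time; the Euler operator acts on what
    remains as the scalar e, which passes back through V and R by linearity. *)
Theorem hbar_ddhbar_Zpot :
  hbar_ddhbar (Zpot r DT s alpha tau) = Hhat r chi alpha (Zpot r DT s alpha tau).
Proof.
apply/funext => e; have lR := lowers_rop r; have lV := lowers_vtot W awt_gt0 chi.
rewrite /hbar_ddhbar /Hhat /=; set Z := Zpot r DT s alpha tau.
have Rinv : Rhat_inv r Z e = pexp (P := W) (vtot (W := W) chi) (Phi e).
  apply: etrans (exp_op_hlift (P := R1) _ _ _) _.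
  by rewrite /Z ZpotE; exact: (pexpN _ lR).
have Vinv : Vhat_inv chi (Rhat_inv r Z) e = Phi e.
  by rewrite Vhat_invE Rinv; exact: (pexpN _ lV).
have E : L0sum alpha (Vhat_inv chi (Rhat_inv r Z)) e = e%:~R *: Phi e.
  rewrite /L0sum /hlift Vinv.
  exact: (Euler_homog awt_gt0 awt_mul (@homog_Phi e)).
apply/esym; apply: etrans (exp_op_hlift (P := R1) _ _ _) _.
rewrite VhatE E.
apply: etrans (congr1 _ (linopZ (lowers_pexp lV).1 _ _)) _.
apply: etrans (linopZ (lowers_pexp lR).1 _ _) _.
exact: (congr1 ( *:%R _) (esym (ZpotE e))).
Qed.

End AncestorPotential.

(** * The result over the complex numbers *)

Local Open Scope complex_scope.

Theorem proposition6p7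
  (R : realType) (N : nat) (hN : (1 <= N)%N)
  (tau : 'I_2 -> nat -> {malg R[i][{cmonom nat}]})
  (htau : forall al : 'I_2, is_tau al (tau al))
  (alpha : 'I_N -> 'I_2)
  (r Rz : nat -> 'M[R[i]]_N)
  (hr : r 0%N = 0)
  (hRz : Rz = mexp r)
  (DT : 'I_N -> nat -> R[i])
  (hDT0 : forall a, DT a 0%N = 0)
  (hDT1 : forall a, alpha a = 1%N :> nat -> DT a 1%N = 0)
  (Delta sqrtDelta : 'I_N -> R[i])
  (hDelta : forall a, sqrtDelta a ^+ 2 = Delta a)
  (chi : 'I_N -> nat -> R[i])
  (hchi : forall a,
     fser (sqrtDelta a) (alpha a) (DT a) = exp_field (chi a) (zser R[i])) :
  hbar_ddhbar (Zpot r DT sqrtDelta alpha tau)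
  = Hhat r chi alpha (Zpot r DT sqrtDelta alpha tau).
Proof.
exact: (hbar_ddhbar_Zpot htau hDT0 hDT1 hchi r).
Qed.
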